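(* There is a randomized polynomial-time algorithm that, on input a graph $G=(V,E)$ with edge lengths $\ell_G:E\to\mathbb{R}_{\ge0}$ and terminals $K\subseteq V$ with $|K|=k$, produces a (random) connected $0$-extension $f:V\to K$ with $$\mathbb{E}\big[d_{H}(f(u),f(v))\big]\le O(\log k)\cdot d_G(u,v)\qquad\text{for all }u,v\in V,$$ where $H=H_f$.
   Context: $d_G:V\times V\to\mathbb{R}_{\ge0}$ denotes shortest-path distance in $(G,\ell_G)$ (in particular $G$ is connected). A retraction is a map $f:V\to K$ with $f(x)=x$ for all $x\in K$. Here a $0$-extension is a retraction $f$ together with the graph $H_f=(K,E_f)$, $E_f=\{(f(u),f(v)):(u,v)\in E\}$, with edge lengths $\ell_{H_f}(x,y)=d_G(x,y)$ for $(x,y)\in E_f$; $d_{H_f}$ is its shortest-path distance. The $0$-extension $f$ is connected if for every $x\in K$ the set $f^{-1}(x)$ induces a connected subgraph of $G$. The $O(\cdot)$ hides an absolute constant, for $k\ge 2$. *)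

(* Defs.v *)
From HB Require Import structures.
From mathcomp Require Import all_boot all_order all_algebra.
From mathcomp Require Import all_classical all_reals all_analysis.

Set Implicit Arguments.
Unset Strict Implicit.
Unset Printing Implicit Defensive.

Import Order.TTheory GRing.Theory Num.Theory.
Local Open Scope ring_scope.

Section Distance.
Context {R : realType} {V : finType}.
Implicit Types (e : rel V) (l : V -> V -> R).

(* [p] lists the vertices visited after the starting point [u]. *)
Fixpoint walk_length l (u : V) (p : seq V) : R :=
  if p is v :: q then l u v + walk_length l v q else 0.

(* Only meant for connected graphs: between two vertices that are not joined
   by a walk it would be [inf set0 = 0]. *)
Definition dist e l (u v : V) : R :=
  inf [set walk_length l u p | p in [set p | path e u p /\ last u p = v]]%classic.

End Distance.

Definition induces_connected (V : finType) (e : rel V) (S : {set V}) : Prop :=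
  forall u v, u \in S -> v \in S ->
    connect [rel a b | [&& a \in S, b \in S & e a b]] u v.

(** * 0-extensions *)

(* The set of terminals as a type: the vertex type of H_f. *)
Definition terminal (V : finType) (K : {set V}) : finType := {x : V | x \in K}.

Section ZeroExtension.
Context {R : realType} {V : finType}.
Variables (e : rel V) (l : V -> V -> R) (K : {set V}).
Implicit Type f : {ffun V -> terminal K}.

Definition retraction f : Prop := forall x : terminal K, f (val x) = x.

(* H_f; an edge of G inside a fibre of f gives a loop, of length 0. *)
Definition Hedge f : rel (terminal K) :=
  [rel x y | [exists u, exists v, [&& e u v, f u == x & f v == y]]].

Definition Hlen (x y : terminal K) : R := dist e l (val x) (val y).

Definition Hdist f (x y : terminal K) : R := dist (Hedge f) Hlen x y.

Definition connected_0ext f : Prop :=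
  retraction f /\
  forall x : terminal K, induces_connected e [set v | f v == x].

End ZeroExtension.

(** * Randomized polynomial time

   Since edge lengths are real numbers, the machine is a randomized real RAM,
   programmed in a WHILE language.  Its memory consists of two-dimensional
   arrays of naturals and of reals, all initially 0 except for the input.  A
   scalar variable is entry (0,0) of an array, and array names occur as
   literals in programs.  Every executed assignment, coin flip and test costs
   one unit; expressions may be nested, but their size is bounded by the
   program.

   There is deliberately no multiplication, of naturals or of reals, and
   reals can neither be rounded nor converted to naturals: in t steps the bit
   size of a natural, or of a rational, grows by at most O(t) over the
   total size of the input, so the unit cost measure hides no superpolynomial
   work, and on rational lengths polynomial time here is polynomial time on a
   Turing machine. *)

Inductive nexp : Type :=
| NConst of nat
| NGet (a : nat) (i j : nexp)
| NAdd of nexp & nexp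
| NSub of nexp & nexp.

Inductive rexp : Type :=
| RGet (a : nat) (i j : nexp)
| RAdd of rexp & rexp
| RSub of rexp & rexp
| RHalf of rexp.

Inductive test : Type :=
| NLe of nexp & nexp
| RLe of rexp & rexp
| TNot of test
| TAnd of test & test.

Inductive cmd : Type :=
| Skip
| Seq of cmd & cmd
| NSet (a : nat) (i j : nexp) (x : nexp)
| RSet (a : nat) (i j : nexp) (x : rexp)
| Flip (a : nat) (i j : nexp)
| If of test & cmd & cmd
| While of test & cmd.

Section Semantics.
Context {R : realType}.

Record state : Type := State {
  nmem : nat -> nat -> nat -> nat;
  rmem : nat -> nat -> nat -> R;
  coins : seq bool   (* outcomes of the coin flips still to come *)
}.

Definition upd (T : Type) (m : nat -> nat -> nat -> T) (a i j : nat) (x : T) :=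
  fun a' i' j' => if [&& a' == a, i' == i & j' == j] then x else m a' i' j'.

Fixpoint neval (s : state) (x : nexp) : nat :=
  match x with
  | NConst n => n
  | NGet a i j => nmem s a (neval s i) (neval s j)
  | NAdd y z => (neval s y + neval s z)%N
  | NSub y z => (neval s y - neval s z)%N
  end.

Fixpoint reval (s : state) (x : rexp) : R :=
  match x with
  | RGet a i j => rmem s a (neval s i) (neval s j)
  | RAdd y z => reval s y + reval s z
  | RSub y z => reval s y - reval s z
  | RHalf y => reval s y / 2%:R
  end.

Fixpoint teval (s : state) (b : test) : bool :=
  match b with
  | NLe x y => (neval s x <= neval s y)%N
  | RLe x y => reval s x <= reval s y
  | TNot b => ~~ teval s b
  | TAnd b c => teval s b && teval s c
  end.

(* [exec c s t s']: started in [s], [c] halts in [s'] after exactly [t] steps.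
   A coin flip with no outcome left is stuck. *)
Inductive exec : cmd -> state -> nat -> state -> Prop :=
| ExecSkip s : exec Skip s 0 s
| ExecSeq c1 c2 s1 s2 s3 t1 t2 :
    exec c1 s1 t1 s2 -> exec c2 s2 t2 s3 -> exec (Seq c1 c2) s1 (t1 + t2) s3
| ExecNSet a i j x s :
    exec (NSet a i j x) s 1
      (State (upd (nmem s) a (neval s i) (neval s j) (neval s x))
             (rmem s) (coins s))
| ExecRSet a i j x s :
    exec (RSet a i j x) s 1
      (State (nmem s)
             (upd (rmem s) a (neval s i) (neval s j) (reval s x)) (coins s))
| ExecFlip a i j s b w :
    coins s = b :: w ->
    exec (Flip a i j) s 1
      (State (upd (nmem s) a (neval s i) (neval s j) (nat_of_bool b))
             (rmem s) w)
| ExecIfTrue b c1 c2 s t s' :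
    teval s b -> exec c1 s t s' -> exec (If b c1 c2) s t.+1 s'
| ExecIfFalse b c1 c2 s t s' :
    ~~ teval s b -> exec c2 s t s' -> exec (If b c1 c2) s t.+1 s'
| ExecWhileFalse b c s :
    ~~ teval s b -> exec (While b c) s 1 s
| ExecWhileTrue b c s1 s2 s3 t1 t2 :
    teval s1 b -> exec c s1 t1 s2 -> exec (While b c) s2 t2 s3 ->
    exec (While b c) s1 (t1 + t2).+1 s3.

Definition halts_within (T : nat) (c : cmd) (s s' : state) : Prop :=
  exists2 t : nat, (t <= T)%N & exec c s t s'.

(** ** Encoding of inputs and outputs *)

(* A table over vertices 0, ..., n-1 as a memory array, padded with [x0]. *)
Definition table (T : Type) (x0 : T) n (m : 'I_n -> 'I_n -> T) (i j : nat) : T :=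
  match insub i : option 'I_n, insub j : option 'I_n with
  | Some u, Some v => m u v
  | _, _ => x0
  end.

(* Natural array 0 holds n at (0,0), array 1 the adjacency matrix, and array 2
   the indicator of K on its diagonal; real array 0 holds the edge lengths. *)
Definition input n (e : rel 'I_n) (l : 'I_n -> 'I_n -> R) (K : {set 'I_n})
    (w : seq bool) : state :=
  State
    (fun a i j =>
       match a with
       | 0 => if (i == 0%N) && (j == 0%N) then n else 0%N
       | 1 => table 0%N (fun u v => nat_of_bool (e u v)) i j
       | 2 => table 0%N (fun u v => nat_of_bool ((u == v) && (u \in K))) i j
       | _ => 0%N
       end)
    (fun a i j =>
       match a with
       | 0 => table 0 (fun u v => if e u v then l u v else 0) i j
       | _ => 0
       end)
    w.

(* The 0-extension is output as the values of f in natural array 3, column 0,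
   the adjacency matrix of H_f in natural array 4, and the edge lengths of H_f
   in real array 1. *)
Definition outputs n (e : rel 'I_n) (l : 'I_n -> 'I_n -> R) (K : {set 'I_n})
    (f : {ffun 'I_n -> terminal K}) (s : state) : Prop :=
  [/\ forall u : 'I_n, nmem s 3 u 0%N = val (f u) :> nat,
      forall x y : terminal K,
        nmem s 4 (val x) (val y) = nat_of_bool (Hedge e f x y) &
      forall x y : terminal K,
        Hedge e f x y -> rmem s 1 (val x) (val y) = Hlen e l x y].

(* Expectation over T independent fair coin flips. *)
Definition coin_expectation (T : nat) (X : T.-tuple bool -> R) : R :=
  (\sum_(w : T.-tuple bool) X w) / 2%:R ^+ T.

End Semantics.

(* Main.v *)
Require Import Defs.
From HB Require Import structures.
From mathcomp Require Import all_boot all_order all_algebra.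
From mathcomp Require Import all_classical all_reals all_analysis.
From mathcomp Require Import zify ring lra.

Set Implicit Arguments.
Unset Strict Implicit.
Unset Printing Implicit Defensive.

Import Order.TTheory GRing.Theory Num.Theory.

(* A terminal t grows its cluster through the unassigned vertices v with
   d(t,v) <= R_t d(v,K), in the order of the terminals and with a fresh random
   radius R_t in [1,3].  Clusters are connected by construction, and they cover
   V because along a shortest path from the nearest terminal the right-hand
   side grows at least as fast as the left-hand side.  R_t - 1 is distributed
   like an exponential variable of rate Theta(log k) cut off at Theta(1), hence
   nearly memoryless: the first cluster to reach an edge uv separates it with
   probability O(log k) l(u,v) / d(u,K), while d(f(u),f(v)) is at most
   O(d(u,K) + l(u,v)).

   Finitely many coins only produce a discrete radius, which could not
   separate a very short edge with a small enough probability.  So edges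
   shorter than 2^-n times the distance of their ends to K are first given
   length 0; then they are never separated, and for all other edges a grid of
   mesh 2^-n / O(log k) is fine enough.  On that grid R_t - 1 becomes
   (2^n g + U) / N with g geometric, truncated at B = ceil(log2 k), U a uniform
   n-bit number and N = B 2^n; all comparisons are scaled by N in order to avoid
   multiplications and divisions. *)

(** * Counting coin sequences *)

(** The union bound over terminals is what fixes B. For an untruncated geometric variable, a grid
    point has mass at most 2^-n times the tail from that point on. Let W be the number of grid
    points that suffice to get from the first end of an edge to the other: a terminal then separates
    the edge with probability at most W / 2^n times the probability that its cluster is the first to
    touch the edge. The touching events of distinct terminals are disjoint, so these terms sum to at
    most W / 2^n, whatever k is. Truncation adds an error 2^-B per terminal inside that factor; 2^B
    >= k keeps the sum of the errors at most 1. The price is a grid of N = B 2^n points per unit of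
    radius, which makes W proportional to B. The threshold at which a terminal first touches an edge
    depends on earlier terminals only. Hence nothing has to be conditioned on: events are counted
    over all coin sequences, and independence becomes invariance under flipping one coin. The bound
    is proved for edges and extends to all pairs by summing along a shortest walk of G. *)

Fixpoint lead (b : nat -> bool) (m : nat) : nat :=
  if m is m'.+1 then
    if (lead b m' == m') && b m' then m else lead b m'
  else 0.

Fixpoint horner2 (b : nat -> bool) (m : nat) : nat :=
  if m is m'.+1 then (horner2 b m').*2 + b m' else 0.

Lemma eq_lead b b' m : (forall i, i < m -> b i = b' i) -> lead b m = lead b' m.
Proof.
elim: m => //= m IH bb'; rewrite IH => [|i im]; last by rewrite bb' // ltnW.
by rewrite bb'.
Qed.

Lemma eq_horner2 b b' m : (forall i, i < m -> b i = b' i) -> horner2 b m = horner2 b' m.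
Proof.
elim: m => //= m IH bb'; rewrite IH => [|i im]; last by rewrite bb' // ltnW.
by rewrite bb'.
Qed.

Lemma lead_le b m : lead b m <= m.
Proof. by elim: m => //= m IH; case: ifP => // _; exact: leqW. Qed.

Lemma lead_full b m : (lead b m.+1 == m.+1) = (lead b m == m) && b m.
Proof.
rewrite /=; case: ifP => [_|_]; first by rewrite eqxx.
by apply/negbTE; rewrite neq_ltn ltnS lead_le.
Qed.

Lemma lead_ge b i m : i <= m -> (i <= lead b m) = (lead b i == i).
Proof.
elim: m => [|m IH]; first by rewrite leqn0 => /eqP ->.
rewrite leq_eqVlt => /orP[/eqP ->|].
  by rewrite eqn_leq lead_le.
rewrite ltnS => im; rewrite -IH //=; case: ifP => // /andP[/eqP -> _].
by rewrite im leqW.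
Qed.

Lemma lead_eq b i m : i < m -> (lead b m == i) = (lead b i == i) && ~~ b i.
Proof.
move=> im; rewrite eqn_leq andbC (lead_ge _ (ltnW im)) leqNgt lead_ge //.
by rewrite lead_full; case: (lead b i == i).
Qed.

Lemma horner2_lt b m : horner2 b m < 2 ^ m.
Proof. by elim: m => //= m IH; rewrite expnS; case: (b m); lia. Qed.

Lemma horner2_eq b m y : (horner2 b m.+1 == y) = (horner2 b m == y./2) && (b m == odd y).
Proof.
rewrite /= -{1}(odd_double_half y); case: (b m); case: (odd y);
  rewrite ?andbT ?andbF ?addn0 ?add0n; lia.
Qed.

(** * Events as counts of coin sequences, and independence as invariance *)

Section Counting.
Variable T : nat.
Implicit Types (A : pred (T.-tuple bool)) (w : T.-tuple bool).

Definition cnt A : nat := \sum_(w : T.-tuple bool) A w.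

Definition toggle (i : nat) w : T.-tuple bool :=
  [tuple tnth w j (+) (val j == i) | j < T].

(** Independence of [A] from coin [i], in a form that needs no probability space. *)
Definition ignores A (i : nat) := forall w, A (toggle i w) = A w.

Lemma nth_toggle i j w : j < T -> nth false (toggle i w) j = nth false w j (+) (j == i).
Proof.
move=> jT; rewrite -[j]/(val (Ordinal jT)) -!tnth_nth tnth_mktuple.
by rewrite (tnth_nth false).
Qed.

Lemma toggleK i : involutive (toggle i).
Proof.
by move=> w; apply: eq_from_tnth => j; rewrite !tnth_mktuple -addbA addbb addbF.
Qed.

Lemma eq_cnt A A' : A =1 A' -> cnt A = cnt A'.
Proof. by move=> AA'; apply: eq_bigr => w _; rewrite AA'. Qed.

Lemma leq_cnt A A' : (forall w, A w -> A' w) -> cnt A <= cnt A'.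
Proof. by move=> AA'; apply: leq_sum => w _; case: (A w) (AA' w) => // ->. Qed.

Lemma cnt_le A : cnt A <= 2 ^ T.
Proof.
apply: leq_trans (_ : \sum_(w : T.-tuple bool) 1 <= _).
  by apply: leq_sum => w _; case: (A w).
by rewrite sum1_card card_tuple card_bool.
Qed.

(** Flipping coin [i] is an involution that preserves [A] and exchanges the two outcomes, so each
    outcome takes half of [A]. *)
Lemma cnt_half A i b : i < T -> ignores A i ->
  2 * cnt (fun w => A w && (nth false w i == b)) = cnt A.
Proof.
move=> iT Ai.
have -> : cnt A = cnt (fun w => A w && (nth false w i == b)) +
                  cnt (fun w => A w && (nth false w i != b)).
  by rewrite -big_split; apply: eq_bigr => w _ /=; case: (A w); case: eqP.
rewrite mul2n -addnn; congr addn.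
rewrite /cnt (reindex_inj (inv_inj (toggleK i))); apply: eq_bigr => w _.
by rewrite Ai nth_toggle // eqxx; case: (nth _ _ _); case: b.
Qed.

Lemma ignores_and A A' i : ignores A i -> ignores A' i ->
  ignores (fun w => A w && A' w) i.
Proof. by move=> h h' w; rewrite h h'. Qed.

Section Row.
(* [g] and [u] give the positions of the coins of one terminal on the tape. *)
Variables (g u : nat -> nat) (B n : nat).
Hypotheses (gT : forall i, i < B -> g i < T) (uT : forall i, i < n -> u i < T).
Hypotheses (g_inj : forall i j, i < B -> j < B -> (g i == g j) = (i == j)).
Hypotheses (u_inj : forall i j, i < n -> j < n -> (u i == u j) = (i == j)).
Hypothesis gu : forall i j, i < B -> j < n -> g i <> u j.

(** The geometric part is the initial run of heads, cut off after [B] coins; the uniform part is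
    read with its most significant bit first, which lets a machine without multiplication build it
    by doublings. *)
Definition coin_lead w := lead (fun i => nth false w (g i)).
Definition coin_unif w := horner2 (fun i => nth false w (u i)).
Definition coin_value w := coin_lead w B * 2 ^ n + coin_unif w n.

Lemma lead_ignores i m x : m <= i -> i < B -> ignores (fun w => coin_lead w m == x) (g i).
Proof.
move=> mi iB w; rewrite /coin_lead; congr (_ == _); apply: eq_lead => j jm.
have jB : j < B by lia.
by rewrite nth_toggle ?gT // g_inj //; case: eqP => [|_]; [lia|rewrite addbF].
Qed.

Lemma lead_ignores_u i x : i < n -> ignores (fun w => coin_lead w B == x) (u i).
Proof.
move=> i_n w; rewrite /coin_lead; congr (_ == _); apply: eq_lead => j jB.
by rewrite nth_toggle ?gT //; case: eqP => [/gu|_]; [case|rewrite addbF].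
Qed.

Lemma unif_ignores i m x : m <= i -> i < n -> ignores (fun w => coin_unif w m == x) (u i).
Proof.
move=> mi i_n w; rewrite /coin_unif; congr (_ == _); apply: eq_horner2 => j jm.
have jn : j < n by lia.
by rewrite nth_toggle ?uT // u_inj //; case: eqP => [|_]; [lia|rewrite addbF].
Qed.

Lemma cnt_lead_full A m : m <= B -> (forall i, i < B -> ignores A (g i)) ->
  2 ^ m * cnt (fun w => A w && (coin_lead w m == m)) = cnt A.
Proof.
move=> + Ag; elim: m => [_|m IH mB].
  by rewrite mul1n; apply: eq_cnt => w; rewrite andbT.
rewrite -IH ?(ltnW mB) // expnSr -mulnA; congr (_ * _).
rewrite -(@cnt_half (fun w => A w && (coin_lead w m == m)) (g m) true (gT mB)).
  by congr (_ * _); apply: eq_cnt => w; rewrite /coin_lead lead_full andbA eqb_id.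
by apply: ignores_and; [exact: Ag|exact: lead_ignores].
Qed.

(** Memorylessness: after m heads, a tail is as likely as one more head. *)
Lemma cnt_lead_eq A m : m < B -> (forall i, i < B -> ignores A (g i)) ->
  cnt (fun w => A w && (coin_lead w B == m)) =
  cnt (fun w => A w && (coin_lead w m.+1 == m.+1)).
Proof.
move=> mB Ag; have half b := @cnt_half (fun w => A w && (coin_lead w m == m)) (g m) b (gT mB).
apply/eqP; rewrite -(@eqn_pmul2l 2) //; apply/eqP.
rewrite (@eq_cnt _ (fun w => A w && (coin_lead w m == m) && (nth false w (g m) == false))).
  rewrite (@eq_cnt (fun w => _ && (_ == _.+1))
    (fun w => A w && (coin_lead w m == m) && (nth false w (g m) == true))).
    by rewrite !half //; apply: ignores_and; [exact: Ag|exact: lead_ignores|exact: Ag|exact: lead_ignores].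
  by move=> w; rewrite /coin_lead lead_full eqb_id andbA.
by move=> w; rewrite /coin_lead lead_eq // eqbF_neg andbA.
Qed.

Lemma cnt_unif_le A m y : m <= n -> (forall i, i < n -> ignores A (u i)) ->
  2 ^ m * cnt (fun w => A w && (coin_unif w m == y)) <= cnt A.
Proof.
move=> + Au; elim: m y => [|m IH] y mn.
  by rewrite mul1n; apply: leq_cnt => w /andP[].
apply: leq_trans (IH y./2 (ltnW mn)); rewrite expnSr -mulnA leq_mul2l; apply/orP; right.
rewrite -(@cnt_half (fun w => A w && (coin_unif w m == y./2)) (u m) (odd y) (uT mn)).
  rewrite leq_mul2l; apply: leq_cnt => w.
  by rewrite /coin_unif horner2_eq andbA.
by apply: ignores_and; [exact: Au|exact: unif_ignores].
Qed.

(* The value has density proportional to its own tail probability, up to the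
   error [2 ^- B] from cutting the geometric part off. *)
Lemma cnt_coin_value A x0 x : x0 <= x ->
  (forall i, i < B -> ignores A (g i)) -> (forall i, i < n -> ignores A (u i)) ->
  2 ^ B * (2 ^ n * cnt (fun w => A w && (coin_value w == x))) <=
  2 ^ B * cnt (fun w => A w && (x0 <= coin_value w)) + cnt A.
Proof.
(* The uniform part is below [2 ^ n], so the value [x] determines both parts as its quotient and its
   remainder. *)
move=> x0x Ag Au; set i := x %/ 2 ^ n.
have n0 : 0 < 2 ^ n by rewrite expn_gt0.
have h1 : 2 ^ n * cnt (fun w => A w && (coin_value w == x)) <=
    cnt (fun w => A w && (coin_lead w B == i)).
  apply: leq_trans (@cnt_unif_le _ n (x %% 2 ^ n) (leqnn n) _); last first.
    by move=> j jn; apply: ignores_and; [exact: Au|exact: lead_ignores_u].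
  rewrite leq_mul2l; apply/orP; right; apply: leq_cnt => w /andP[-> /eqP vx].
  by rewrite /i -vx /coin_value divnMDl // divn_small ?horner2_lt // addn0 modnMDl modn_small ?horner2_lt ?eqxx.
apply: leq_trans (_ : 2 ^ B * cnt (fun w => A w && (coin_lead w B == i)) <= _).
  by rewrite leq_mul2l h1 orbT.
have [iB|Bi] := ltnP i B.
  (* Trade a run of exactly [i] for a run of at least [i.+1]: the latter forces a value above [x],
     hence at least [x0]. *)
  apply: leq_trans (leq_addr _ _); rewrite leq_mul2l; apply/orP; right.
  rewrite cnt_lead_eq //; apply: leq_cnt => w /andP[-> il] /=.
  have : i.+1 <= coin_lead w B by rewrite /coin_lead lead_ge.
  move=> h; rewrite /coin_value; apply: leq_trans (leq_addr _ _).
  apply: leq_trans x0x (leq_trans (ltnW (ltn_ceil x n0)) _).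
  by rewrite leq_mul2r h orbT.
(* Here only an uninterrupted run of [B] heads is possible, and this is the truncation error. *)
apply: leq_trans (leq_addl _ _); rewrite -(@cnt_lead_full A B) // leq_mul2l; apply/orP; right.
apply: leq_cnt => w /andP[-> /eqP h] /=; have := lead_le (fun j => nth false w (g j)) B.
by rewrite -/(coin_lead w B) h eqn_leq Bi andbT.
Qed.

End Row.
End Counting.

(** * A language of bounded loops *)

(* Programs whose loops run exactly [n] times, where [n] is the number of
   vertices; [v] in [PFor v p] names the array whose entry (0,0) counts. *)
Inductive prog : Type :=
| PSeq of prog & prog
| PN (a : nat) (i j : nexp) (x : nexp)
| PR (a : nat) (i j : nexp) (x : rexp)
| PFlip (a : nat) (i j : nexp)
| PIf of test & prog & prog
| PSkip
| PFor of nat & prog.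

Definition scal (a : nat) : nexp := NGet a (NConst 0) (NConst 0).

Fixpoint compile (p : prog) : cmd :=
  match p with
  | PSeq p q => Seq (compile p) (compile q)
  | PN a i j x => NSet a i j x
  | PR a i j x => RSet a i j x
  | PFlip a i j => Flip a i j
  | PIf b p q => If b (compile p) (compile q)
  | PSkip => Skip
  | PFor v p =>
      Seq (NSet v (NConst 0) (NConst 0) (NConst 0))
          (While (TNot (NLe (scal 0) (scal v)))
             (Seq (compile p)
                (NSet v (NConst 0) (NConst 0) (NAdd (scal v) (NConst 1)))))
  end.

Fixpoint cost (n : nat) (p : prog) : nat :=
  match p with
  | PSeq p q => cost n p + cost n q
  | PIf _ p q => (cost n p + cost n q).+1
  | PSkip => 0
  | PFor _ p => (n * (cost n p).+2).+2
  | _ => 1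
  end.

(** The 4 added for a loop pays for its control, 2 n + 2 steps, which is at most 4 n for positive
    n. *)
Fixpoint prog_size (p : prog) : nat :=
  match p with
  | PSeq p q | PIf _ p q => (prog_size p + prog_size q).+1
  | PFor _ p => (prog_size p).+4
  | _ => 1
  end.

Fixpoint depth (p : prog) : nat :=
  match p with
  | PSeq p q | PIf _ p q => maxn (depth p) (depth q)
  | PFor _ p => (depth p).+1
  | _ => 0
  end.

Fixpoint nwrites (p : prog) : seq nat :=
  match p with
  | PSeq p q | PIf _ p q => nwrites p ++ nwrites q
  | PN a _ _ _ | PFlip a _ _ => [:: a]
  | PFor v p => v :: nwrites p
  | _ => [::]
  end.

Fixpoint rwrites (p : prog) : seq nat :=
  match p with
  | PSeq p q | PIf _ p q => rwrites p ++ rwrites q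
  | PR a _ _ _ => [:: a]
  | PFor _ p => rwrites p
  | _ => [::]
  end.

Fixpoint wf (p : prog) : bool :=
  match p with
  | PSeq p q | PIf _ p q => wf p && wf q
  | PFor v p => (v \notin nwrites p) && wf p
  | _ => true
  end.

Lemma cost_le n p : (0 < n)%N -> (cost n p <= prog_size p * n ^ depth p)%N.
Proof.
move=> n0; have mono a b c : (a <= b -> c * n ^ a <= c * n ^ b)%N.
  by move=> ab; rewrite leq_mul2l leq_pexp2l ?orbT.
have H p1 p2 q1 q2 : (p1 <= prog_size q1 * n ^ depth q1 ->
    p2 <= prog_size q2 * n ^ depth q2 ->
    (p1 + p2).+1 <= (prog_size q1 + prog_size q2).+1 * n ^ maxn (depth q1) (depth q2))%N.
  move=> le1 le2; rewrite -addn1 -[X in (_ <= X * _)%N]addn1 !mulnDl mul1n leq_add ?expn_gt0 ?n0 //.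
  by apply: leq_add; [apply: leq_trans le1 _|apply: leq_trans le2 _];
    rewrite mono // ?leq_maxl ?leq_maxr.
elim: p => //= [p IHp q IHq|b p IHp q IHq|v p IHp]; first by apply: leq_trans (H _ _ _ _ IHp IHq).
  exact: H.
have : (0 < n ^ depth p)%N by rewrite expn_gt0 n0.
rewrite expnS; move: IHp; move: (n ^ _)%N (prog_size p) (cost n p) => x y z.
nia.
Qed.

Local Open Scope ring_scope.

Section Denotation.
Context {R : realType}.
Implicit Types s : @state R.

Definition set_var v (x : nat) s : state :=
  State (upd (nmem s) v 0 0 x)%N (rmem s) (coins s).

(** A total function, in contrast to [exec]: an exhausted tape yields [false]. In [exec_den] the
    tape is at least as long as the cost, so this default is not met there. *)
Fixpoint den (n : nat) (p : prog) s : state :=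
  match p with
  | PSeq p q => den n q (den n p s)
  | PN a i j x => State (upd (nmem s) a (neval s i) (neval s j) (neval s x))
                        (rmem s) (coins s)
  | PR a i j x => State (nmem s)
                    (upd (rmem s) a (neval s i) (neval s j) (reval s x)) (coins s)
  | PFlip a i j => State (upd (nmem s) a (neval s i) (neval s j)
                              (nat_of_bool (head false (coins s))))
                         (rmem s) (behead (coins s))
  | PIf b p q => if teval s b then den n p s else den n q s
  | PSkip => s
  | PFor v p => iteri n (fun i s => set_var v i.+1 (den n p s)) (set_var v 0 s)
  end.

Lemma den_nmem n p s a i j :
  a \notin nwrites p -> nmem (den n p s) a i j = nmem s a i j.
Proof.
elim: p s => //= [p IHp q IHq|b i' j' x|b i' j'|b p IHp q IHq|v p IHp] s.
- by rewrite mem_cat negb_or => /andP[ap aq]; rewrite IHq // IHp.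
- by rewrite inE /upd => /negbTE ->.
- by rewrite inE /upd => /negbTE ->.
- by rewrite mem_cat negb_or => /andP[ap aq]; case: ifP => _; rewrite ?IHq ?IHp.
- rewrite inE negb_or => /andP[/negbTE av ap].
  by move: {1}n => k; elim: k => /= [|m IH]; rewrite /upd av ?IHp.
Qed.

Lemma den_rmem n p s a i j :
  a \notin rwrites p -> rmem (den n p s) a i j = rmem s a i j.
Proof.
elim: p s => //= [p IHp q IHq|b i' j' x|b p IHp q IHq|v p IHp] s.
- by rewrite mem_cat negb_or => /andP[ap aq]; rewrite IHq // IHp.
- by rewrite inE /upd => /negbTE ->.
- by rewrite mem_cat negb_or => /andP[ap aq]; case: ifP => _; rewrite ?IHq ?IHp.
- by move=> ap; move: {1}n => k; elim: k => //= m IH; rewrite IHp.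
Qed.

(** The last conjunct, at most one coin per step, is what carries the assumption on the tape through
    sequences and loop iterations. *)
Lemma exec_den n p s : wf p -> 0%N \notin nwrites p -> nmem s 0 0 0 = n ->
  (cost n p <= size (coins s))%N ->
  exists t, [/\ (t <= cost n p)%N, exec (compile p) s t (den n p s) &
    (size (coins s) <= size (coins (den n p s)) + t)%N].
Proof.
elim: p s => /= [p IHp q IHq|a i j x|a i j x|a i j|b p IHp q IHq||v p IHp] s.
- rewrite mem_cat negb_or => /andP[wp wq] /andP[p0 q0] sn sc.
  have [//|t1 [t1c e1 c1]] := IHp s wp p0 sn; first by lia.
  have [||t2 [t2c e2 c2]] := IHq (den n p s) wq q0; first by rewrite den_nmem.
    by lia.
  exists (t1 + t2)%N; split; [lia|exact: ExecSeq e1 e2|lia].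
- by exists 1%N; split => //; [exact: ExecNSet|rewrite /= leq_addr].
- by exists 1%N; split => //; [exact: ExecRSet|rewrite /= leq_addr].
- move=> _ _ _; case E: (coins s) => [//|c w] _.
  by exists 1%N; split => //=; [exact: ExecFlip|rewrite addn1].
- rewrite mem_cat negb_or => /andP[wp wq] /andP[p0 q0] sn sc.
  case: ifPn => bs.
    have [//|t [tc et ct]] := IHp s wp p0 sn; first by lia.
    by exists t.+1; split; [lia|exact: ExecIfTrue|lia].
  have [//|t [tc et ct]] := IHq s wq q0 sn; first by lia.
  by exists t.+1; split; [lia|exact: ExecIfFalse|lia].
- by move=> _ _ _ _; exists 0%N; split => //; [exact: ExecSkip|rewrite addn0].
move=> /andP[vp wp]; rewrite inE negb_or eq_sym => /andP[v0 p0] sn sc.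
pose body := fun i s' => set_var v i.+1 (den n p s'); pose s0 := set_var v 0 s.
have get0 i x s' : nmem (set_var v x s') 0 i i = nmem s' 0 i i.
  by rewrite /= /upd eq_sym (negbTE v0).
have stepE i : iteri i.+1 body s0 = set_var v i.+1 (den n p (iteri i body s0)) by [].
have stn i : nmem (iteri i body s0) 0 0 0 = n.
  elim: i => [|i IH]; first by rewrite get0.
  by rewrite stepE get0 den_nmem.
have stv i : nmem (iteri i body s0) v 0 0 = i by case: i => [|i]; rewrite ?stepE /= /upd !eqxx.
have loop m i : (i + m = n)%N -> (m * (cost n p).+2 < size (coins (iteri i body s0)))%N ->
    exists t, [/\ (t <= (m * (cost n p).+2).+1)%N,
     exec (While (TNot (NLe (scal 0) (scal v)))
             (Seq (compile p)
                (NSet v (NConst 0) (NConst 0) (NAdd (scal v) (NConst 1)))))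
       (iteri i body s0) t (iteri n body s0) &
     (size (coins (iteri i body s0)) <= size (coins (iteri n body s0)) + t)%N].
  elim: m i => [|m IH] i imn isz.
    exists 1%N; rewrite -imn addn0; split => //; last by rewrite leq_addr.
    by apply: ExecWhileFalse; rewrite /= negbK stn stv -imn addn0.
  have [|t [tc et ct]] := IHp (iteri i body s0) wp p0 (stn i); first by lia.
  have ct2 : (size (coins (iteri i body s0)) <= size (coins (iteri i.+1 body s0)) + t)%N by [].
  have [||t2 [tc2 et2 ct2']] := IH i.+1; [by lia|by move: isz ct2; rewrite mulSn; lia|].
  exists (t + 1 + t2).+1; split; [by rewrite mulSn; lia| |by lia].
  apply: ExecWhileTrue et2; first by rewrite /= stn stv -imn; lia.
  apply: ExecSeq et _.
  have := ExecNSet v (NConst 0) (NConst 0) (NAdd (scal v) (NConst 1)) (den n p (iteri i body s0)).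
  by rewrite /= den_nmem // stv addn1.
have [//||t [tc et ct]] := loop n 0%N; first exact: ltnW.
exists t.+1; split; [by lia| |by rewrite addnS; exact: leqW].
by rewrite -[t.+1]add1n; apply: ExecSeq et; exact: ExecNSet.
Qed.

(** The rule supplies the frame conditions itself, so an invariant need only mention the arrays that
    the body changes. *)
Lemma den_for_ind (I : nat -> state -> Prop) n v p s0 :
  (forall i x s, I i s -> I i (set_var v x s)) ->
  v \notin nwrites p ->
  (forall (i : 'I_n) s, nmem s v 0 0 = i ->
    (forall a x y, a \notin v :: nwrites p -> nmem s a x y = nmem s0 a x y) ->
    (forall a x y, a \notin rwrites p -> rmem s a x y = rmem s0 a x y) ->
    I i s -> I i.+1 (den n p s)) ->
  I 0%N s0 -> I n (den n (PFor v p) s0).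
Proof.
move=> Iv vp Ib I0 /=.
pose body := fun i s => set_var v i.+1 (den n p s); rewrite -/body.
suff H i : (i <= n)%N -> [/\ nmem (iteri i body (set_var v 0 s0)) v 0 0 = i,
    forall a x y, a \notin v :: nwrites p ->
      nmem (iteri i body (set_var v 0 s0)) a x y = nmem s0 a x y,
    forall a x y, a \notin rwrites p ->
      rmem (iteri i body (set_var v 0 s0)) a x y = rmem s0 a x y &
    I i (iteri i body (set_var v 0 s0))] by have [] := H n (leqnn n).
elim: i => [_|i IH ilt].
  split => //=; [by rewrite /upd !eqxx| |exact: Iv].
  by move=> a x y; rewrite inE negb_or /upd => /andP[/negbTE ->].
have [|e1 e2 e3 e4] := IH; first exact: ltnW.
split => /=.
- by rewrite /upd !eqxx.
- move=> a x y ap; rewrite /upd; move: (ap).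
  by rewrite inE negb_or => /andP[/negbTE -> ap']; rewrite den_nmem // e2.
- by move=> a x y ap; rewrite den_rmem // e3.
- by apply/Iv/(Ib (Ordinal ilt)).
Qed.

(** For loops in which iteration [i] achieves a goal [G i] that later iterations preserve; [le] is
    the preorder of progress. *)
Lemma den_for_le (le : state -> state -> Prop) n (G : 'I_n -> state -> Prop) v p s0 :
  (forall s, le s s) -> (forall s1 s2 s3, le s1 s2 -> le s2 s3 -> le s1 s3) ->
  (forall x s, le s (set_var v x s)) ->
  (forall i s s', G i s -> le s s' -> G i s') ->
  v \notin nwrites p ->
  (forall (i : 'I_n) s, nmem s v 0 0 = i ->
    (forall a x y, a \notin v :: nwrites p -> nmem s a x y = nmem s0 a x y) ->
    (forall a x y, a \notin rwrites p -> rmem s a x y = rmem s0 a x y) ->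
    le s0 s -> le s (den n p s) /\ G i (den n p s)) ->
  le s0 (den n (PFor v p) s0) /\ forall i, G i (den n (PFor v p) s0).
Proof.
move=> lexx letr lev Gle vp Ib.
have [|//|||H1 H2] := @den_for_ind (fun m s => le s0 s /\ forall i : 'I_n, (i < m)%N -> G i s) n v p s0.
- move=> m x s [ls Gs]; split; first exact: letr (lev x s).
  by move=> i im; apply: Gle (Gs i im) _.
- move=> i s sv f1 f2 [ls Gs]; have [l2 Gi] := Ib i s sv f1 f2 ls.
  split; first exact: letr l2.
  move=> j; rewrite ltnS leq_eqVlt => /orP[/eqP/val_inj -> //|ji].
  by apply: Gle (Gs j ji) _.
- by split.
by split => // i; apply: H2.
Qed.

End Denotation.

(** * Shortest-path distances *)

Section WalkLength.
Context {R : realType} {V : finType}.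
Variables (e : rel V) (l : V -> V -> R).

Lemma walk_length_cat u p q :
  walk_length l u (p ++ q) = walk_length l u p + walk_length l (last u p) q.
Proof. by elim: p u => [|v p IH] u /=; rewrite ?add0r // IH addrA. Qed.

Lemma walk_length_rev u p : path e u p ->
  (forall a b, e a b -> l a b = l b a) ->
  walk_length l (last u p) (rev (belast u p)) = walk_length l u p.
Proof.
move=> + lC; elim: p u => [|v p IH] u //= /andP[euv pp].
rewrite rev_cons -cats1 walk_length_cat IH //= addr0 addrC; congr (_ + _).
suff: last (last v p) (rev (belast v p)) = v by move=> ->; rewrite (lC u v).
by case: p {IH pp} => //= w p; rewrite rev_cons last_rcons.
Qed.

Lemma eq_walk_length (l2 : V -> V -> R) u p :
  (forall a b, e a b -> l a b = l2 a b) -> path e u p ->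
  walk_length l u p = walk_length l2 u p.
Proof.
by move=> El; elim: p u => //= v p IH u /andP[euv pp]; rewrite El // IH.
Qed.

Hypothesis l_ge0 : forall a b, e a b -> 0 <= l a b.

Lemma walk_length_ge0 u p : path e u p -> 0 <= walk_length l u p.
Proof.
by elim: p u => //= v p IH u /andP[euv pp]; rewrite addr_ge0 ?l_ge0 ?IH.
Qed.

Lemma walk_length_shorten u p : path e u p ->
  walk_length l u (shorten u p) <= walk_length l u p.
Proof.
have H q : forall x y, path e y q -> x \in y :: q ->
    walk_length l x (shorten x q) <= walk_length l y q.
  elim: q => [|z q IH] x y //= /andP[eyz pq] xyq.
  case: ifP => xq.
    by apply: le_trans (IH x z pq xq) _; rewrite lerDr l_ge0.
  have -> : x = y by move: xyq; rewrite inE xq orbF => /eqP.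
  by rewrite /= lerD2l IH ?mem_head.
by move=> pp; apply: H => //; rewrite mem_head.
Qed.

Lemma dist_le u v p : path e u p -> last u p = v ->
  dist e l u v <= walk_length l u p.
Proof.
move=> pp lp; apply: ge_inf; last by exists p.
by exists 0 => _ [q [pq _] <-]; exact: walk_length_ge0.
Qed.

Lemma dist_le_edge u v : e u v -> dist e l u v <= l u v.
Proof.
move=> euv; have := @dist_le u v [:: v]; rewrite /= addr0 andbT; exact.
Qed.

Hypothesis e_conn : forall u v, connect e u v.

(** Removing cycles does not lengthen a walk, so the infimum over infinitely many walks is a minimum
    over the finite type of walks with a bounded number of edges. *)
Lemma dist_attained u v : exists p,
  [/\ path e u p, last u p = v, (size p < #|V|)%N & walk_length l u p = dist e l u v].
Proof.
have short p : path e u p -> exists q, [/\ path e u q, last u q = last u p,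
    (size q < #|V|)%N & walk_length l u q <= walk_length l u p].
  move=> pp; exists (shorten u p); have := walk_length_shorten pp.
  case/shortenP: pp => q pq uq _ ->; split => //.
  by rewrite -[(_ < _)%N]/(size (u :: q) <= _)%N -(card_uniqP uq) max_card.
pose P (q : #|V|.-bseq V) := path e u q && (last u q == v).
have toP p : path e u p -> last u p = v -> (size p < #|V|)%N ->
    exists2 q : #|V|.-bseq V, P q & p = q.
  move=> pp lp sp; exists (Bseq (ltnW sp)) => //=.
  by rewrite /P /= pp lp eqxx.
have [p0 pp0 lp0] := connectP (e_conn u v).
have [p1 [pp1 lp1 sp1 _]] := short _ pp0.
have [|q0 Pq0 _] := toP _ pp1 _ sp1; first by rewrite lp1 -lp0.
case: (@arg_minP _ _ _ q0 P (fun q => walk_length l u q) Pq0) => q /andP[pq /eqP lq] qmin.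
have [q' [pq' lq' sq' wq']] := short _ pq.
exists q'; split; rewrite ?lq' //; apply/eqP; rewrite eq_le; apply/andP; split; last first.
  by apply: dist_le => //; rewrite lq'.
apply: lb_le_inf; first by exists (walk_length l u q), (q : seq V).
move=> _ [p [pp lp] <-]; apply: le_trans wq' _.
have [p' [pp' lp' sp' wp']] := short _ pp; apply: le_trans wp'.
have [|q2 Pq2 ->] := toP _ pp' _ sp'; first by rewrite lp'.
exact: qmin.
Qed.

Lemma dist_ge0 u v : 0 <= dist e l u v.
Proof.
by have [p [pp _ _ <-]] := dist_attained u v; exact: walk_length_ge0.
Qed.

Lemma distxx u : dist e l u u = 0.
Proof. by apply/eqP; rewrite eq_le dist_ge0 (@dist_le u u [::]). Qed.

Lemma dist_triangle w u v : dist e l u v <= dist e l u w + dist e l w v.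
Proof.
have [p [pp lp _ <-]] := dist_attained u w.
have [q [pq lq _ <-]] := dist_attained w v.
have := @dist_le u v (p ++ q).
by rewrite cat_path last_cat walk_length_cat lp; apply => //; rewrite pp.
Qed.

Lemma dist_edge w u v : e u v -> dist e l w v <= dist e l w u + l u v.
Proof.
by move=> euv; apply: le_trans (dist_triangle u _ _) _; rewrite lerD2l dist_le_edge.
Qed.

Lemma distC u v : symmetric e -> (forall a b, e a b -> l a b = l b a) ->
  dist e l u v = dist e l v u.
Proof.
move=> eC lC; wlog suff: u v / dist e l u v <= dist e l v u.
  by move=> H; apply/eqP; rewrite eq_le !H.
have [p [pp lp _ <-]] := dist_attained v u.
rewrite -(walk_length_rev pp lC) lp; apply: dist_le.
  by rewrite -{1}lp rev_path (eq_path (e' := e)) // => a b; rewrite eC.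
by case: p {pp} lp => [|a p] /= <- //; rewrite rev_cons last_rcons.
Qed.

End WalkLength.

Lemma eq_dist (R : realType) (V : finType) (e : rel V) (l l2 : V -> V -> R) u v :
  (forall a b, e a b -> l a b = l2 a b) -> dist e l u v = dist e l2 u v.
Proof.
move=> El; rewrite /dist; congr inf; apply/seteqP; split => _ [p [pp lp] <-];
  exists p => //; rewrite (@eq_walk_length _ _ e l l2) //.
Qed.

(** * Sequential clustering *)

Section Clustering.
Context {R : realType} {n : nat}.
Variables (e : rel 'I_n) (dl : 'I_n -> 'I_n -> R) (Dl : 'I_n -> R)
  (K : {set 'I_n}) (N : nat).
Implicit Types (al : 'I_n -> option (terminal K)) (t : terminal K) (X : 'I_n -> nat).

Definition in_reach (x : nat) (t v : 'I_n) : bool :=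
  N%:R * dl t v <= (N + x)%:R * Dl v.

(** Only the target [b] is tested: a growing walk starts at its own terminal, which is already
    assigned, and each later source was a target before. *)
Definition grow al (x : nat) t : rel 'I_n :=
  [rel a b | [&& e a b, al b == None & in_reach x (val t) b]].

Definition hit al (x : nat) t (v : 'I_n) : bool :=
  (al v == None) && connect (grow al x t) (val t) v.

Definition grow_step al (x : nat) t (v : 'I_n) : option (terminal K) :=
  if hit al x t v then Some t else al v.

(* The assignment once the terminals of index smaller than [r] have grown
   their clusters. *)
Fixpoint asg X (r : nat) : 'I_n -> option (terminal K) :=
  if r is r'.+1 then
    if [pick t : terminal K | val t == r' :> nat] is Some t
    then grow_step (asg X r') (X (val t)) t else asg X r'
  else fun v => [pick t : terminal K | val t == v].

Lemma asgS X t : asg X (val t).+1 = grow_step (asg X (val t)) (X (val t)) t.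
Proof.
rewrite /=; case: pickP => [t' /eqP/val_inj/val_inj -> //|/(_ t)].
by rewrite eqxx.
Qed.

Lemma asgSn X r : (forall t, val t <> r :> nat) -> asg X r.+1 = asg X r.
Proof. by move=> tr; rewrite /=; case: pickP => // t /eqP /tr. Qed.

(** Rounds are numbered by vertices, so a round is either idle or belongs to exactly one
    terminal. *)
Lemma asg_ind X (P : nat -> Prop) : P 0 ->
  (forall r, (forall t, val t <> r :> nat) -> P r -> P r.+1) ->
  (forall t, P (val t) -> P (val t).+1) -> forall r, P r.
Proof.
move=> P0 Pn Pt; elim=> // r IH.
have [[t tr]|none] := pselect (exists t : terminal K, val t = r :> nat).
  by rewrite -tr; apply: Pt; rewrite tr.
by apply: Pn => // t tr; apply: none; exists t.
Qed.

Lemma asg0 X v t : asg X 0 v = Some t -> v = val t.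
Proof. by rewrite /=; case: pickP => // t' /eqP <- [->]. Qed.

Lemma asg_terminal X r t : asg X r (val t) = Some t.
Proof.
elim/(asg_ind X): r => [|r /asgSn -> //|t'].
  by rewrite /=; case: pickP => [t' /eqP/val_inj -> //|/(_ t)]; rewrite eqxx.
by rewrite asgS /grow_step /hit => ->.
Qed.

Lemma asg_mono X r r' v t : (r <= r')%N -> asg X r v = Some t -> asg X r' v = Some t.
Proof.
move=> + rt; elim/(asg_ind X): r' => [|r' nt IH|t' IH].
- by rewrite leqn0 => /eqP r0; rewrite r0 in rt.
- by rewrite leq_eqVlt => /orP[/eqP <- //|]; rewrite asgSn // ltnS.
- by rewrite leq_eqVlt => /orP[/eqP <- //|/IH h]; rewrite asgS /grow_step /hit h.
Qed.

Lemma asg_lt X r v t : asg X r v = Some t -> v = val t \/ (val t < r)%N.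
Proof.
elim/(asg_ind X): r => [/asg0|r nt IH|t' IH]; first by left.
  by rewrite asgSn // => /IH [->|?]; [left|right; exact: ltnW].
rewrite asgS /grow_step; case: ifP => _; first by case=> ->; right.
by move=> /IH [->|?]; [left|right; exact: ltnW].
Qed.

Lemma asg_ext X X' r : (forall j : 'I_n, (j < r)%N -> X j = X' j) ->
  asg X r = asg X' r.
Proof.
elim/(asg_ind X): r => [//|r nt IH|t IH] XX'.
  by rewrite !asgSn // IH // => j jr; apply/XX'/ltnW.
by rewrite !asgS IH ?XX' // => j jr; apply/XX'/ltnW.
Qed.

Lemma grow_connect al x t v : connect (grow al x t) (val t) v ->
  v = val t \/ al v = None /\ in_reach x (val t) v.
Proof.
case/connectP => p; elim/last_ind: p => [_ ->|p w _]; first by left.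
rewrite rcons_path last_rcons => /andP[_ /and3P[_ /eqP ? ?]] ->.
by right.
Qed.

Lemma hit_within al x t v : al (val t) = Some t -> hit al x t v ->
  in_reach x (val t) v.
Proof.
by move=> alt /andP[/eqP alv /grow_connect [v_t|[]//]]; move: alv; rewrite v_t alt.
Qed.

Lemma hit_step al x t a b : hit al x t a -> e a b -> al b = None ->
  in_reach x (val t) b -> hit al x t b.
Proof.
move=> /andP[_ ta] eab alb wb; rewrite /hit alb eqxx.
by apply: connect_trans ta (connect1 _); rewrite /grow /= eab alb eqxx.
Qed.

(** In the round of [t], a neighbour [b] of its cluster that is in reach was either taken before or
    extends the walk that reached [a]; later rounds free no vertex. *)
Lemma asg_closed X r a b t : asg X r a = Some t -> (val t < r)%N -> e a b ->
  in_reach (X (val t)) (val t) b -> asg X r b <> None.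
Proof.
elim/(asg_ind X): r => [//|r nt IH|t' IH] at_ tr eab wb.
  rewrite asgSn // in at_ *; apply: IH => //.
  by rewrite ltn_neqAle -ltnS tr andbT; apply/eqP/nt.
move: at_; rewrite asgS /grow_step; case: ifP => [ha [tt']|_ at_].
  subst t'; case: ifP => // /negP hb bN; apply: hb.
  exact: hit_step ha eab bN wb.
case: ifP => // hb; have [a_t|lt] := asg_lt at_; last exact: IH.
move=> bN; have lt : (val t < val t')%N || (t == t').
  by move: tr; rewrite ltnS leq_eqVlt orbC => /orP[-> //|/eqP/val_inj/val_inj ->]; rewrite eqxx orbT.
case/orP: lt => [lt|/eqP tt']; first exact: IH bN.
subst t'; move/negP: hb; apply; rewrite /hit bN eqxx /=.
by apply: connect1; rewrite /grow /= bN eqxx wb -a_t eab.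
Qed.

(** A cluster is grown in a single round, and every vertex on the walk that hits [v] joins it in
    that same round. *)
Lemma asg_fiber X r v t : asg X r v = Some t ->
  connect [rel a b | [&& asg X r a == Some t, asg X r b == Some t & e a b]] (val t) v.
Proof.
elim/(asg_ind X): r v => [v /asg0 -> //|r nt IH|t' IH] v; first by rewrite asgSn // => /IH.
have sub : subrel
  [rel a b | [&& asg X (val t') a == Some t, asg X (val t') b == Some t & e a b]]
  [rel a b | [&& asg X (val t').+1 a == Some t, asg X (val t').+1 b == Some t & e a b]].
  move=> a b /and3P[/eqP ra /eqP rb eab]; apply/and3P.
  by rewrite (asg_mono (leqnSn _) ra) (asg_mono (leqnSn _) rb) !eqxx.
rewrite {1}asgS /grow_step; case: ifP => [hv [tt']|_ /IH c]; last first.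
  by apply: connect_sub c => a b /sub /connect1.
subst t'; move/andP: hv => [_ /connectP[p + ->]].
elim/last_ind: p => [//|p w IHp]; rewrite rcons_path last_rcons => /andP[pp pw].
apply: connect_trans (IHp pp) (connect1 _).
have inS w' q : path (grow (asg X (val t)) (X (val t)) t) (val t) q -> last (val t) q = w' ->
    asg X (val t).+1 w' = Some t.
  move=> pq lq; have cw : connect (grow (asg X (val t)) (X (val t)) t) (val t) w' by apply/connectP; exists q.
  case: (grow_connect cw) => [->|[wN _]]; first exact: asg_terminal.
  by rewrite asgS /grow_step /hit wN cw.
apply/and3P; split; first by rewrite (inS _ p).
  by rewrite (inS _ (rcons p w)) ?last_rcons // rcons_path pp.
by case/and3P: pw.
Qed.

Lemma hit_mono al x y t v : (forall u, 0 <= Dl u) -> (x <= y)%N ->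
  hit al x t v -> hit al y t v.
Proof.
move=> D0 xy /andP[av c]; rewrite /hit av; apply: connect_sub c => a b /and3P[eab bN wb].
apply: connect1; rewrite /grow /= eab bN; apply: le_trans wb _.
by rewrite ler_wpM2r // ler_nat leq_add2l.
Qed.

Section Metric.
Variable lam : 'I_n -> 'I_n -> R.
Hypothesis Dl_ge0 : forall u, 0 <= Dl u.
Hypothesis DlK : forall u, u \in K -> Dl u = 0.
Hypothesis dlxx : forall u, dl u u = 0.
Hypothesis lam_ge0 : forall u v, e u v -> 0 <= lam u v.
Hypothesis dl_edge : forall w u v, e u v -> dl w v <= dl w u + lam u v.
Hypothesis Dl_edge : forall u v, e u v -> Dl v <= Dl u + lam u v.

Lemma asg_within X r v t : asg X r v = Some t -> in_reach (X (val t)) (val t) v.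
Proof.
elim/(asg_ind X): r => [/asg0 ->|r nt IH|t' IH]; last 2 first.
- by rewrite asgSn.
- rewrite asgS /grow_step; case: ifP => [hv [<-]|_ /IH //].
  by apply: hit_within hv; exact: asg_terminal.
by rewrite /in_reach dlxx mulr0 mulr_ge0.
Qed.

(* Along a shortest walk to the nearest terminal [Dl] grows exactly by the
   edge lengths, so the cluster owning one vertex may enter the next one. *)
Lemma asg_walk X a p t : asg X n a = Some t -> path e a p ->
  Dl a + walk_length lam a p <= Dl (last a p) -> asg X n (last a p) <> None.
Proof.
elim: p a t => [a t -> //|b p IH] a t at_ /= /andP[eab pp] Dp.
(* [Dl] grows by at most the length of the rest of the walk, so tightness of the whole walk forces
   its first edge to be tight. *)
have ub : Dl (last b p) <= Dl b + walk_length lam b p.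
  elim: p b pp {IH eab Dp} => [b _|c p IH b /= /andP[ebc pp]] /=; first by rewrite addr0.
  by have := Dl_edge ebc; have := IH c pp; lra.
have Db : Dl a + lam a b <= Dl b by lra.
have wb : in_reach (X (val t)) (val t) b.
  have := asg_within at_; rewrite /in_reach => wa.
  have h1 : N%:R * dl (val t) b <= N%:R * (dl (val t) a + lam a b) :> R.
    by rewrite ler_wpM2l // dl_edge.
  have h2 : (N + X (val t))%:R * (Dl a + lam a b) <= (N + X (val t))%:R * Dl b :> R.
    by rewrite ler_wpM2l.
  have h3 : N%:R * lam a b <= (N + X (val t))%:R * lam a b.
    by rewrite ler_wpM2r ?lam_ge0 // ler_nat leq_addr.
  by rewrite !mulrDr in h1 h2; lra.
have := asg_closed at_ (ltn_ord _) eab wb.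
case Eb: (asg X n b) => [t'|//] _; apply: IH Eb pp _; have := Dl_edge eab; lra.
Qed.

Lemma asg_total X v :
  (exists t : terminal K, exists p,
     [/\ path e (val t) p, last (val t) p = v & walk_length lam (val t) p = Dl v]) ->
  asg X n v <> None.
Proof.
move=> [t [p [pp lp wp]]]; rewrite -lp; apply: asg_walk pp _.
  exact: asg_terminal.
by rewrite lp wp DlK ?add0r // (valP t).
Qed.

Section Edge.
Variables u v : 'I_n.
Hypotheses (euv : e u v) (evu : e v u) (lamC : lam u v = lam v u).

Definition either_hit al x t := hit al x t u || hit al x t v.
Definition both_free al := (al u == None) && (al v == None).
Definition touch X t := both_free (asg X (val t)) && either_hit (asg X (val t)) (X (val t)) t.
Definition splits X t := both_free (asg X (val t)) &&
  (hit (asg X (val t)) (X (val t)) t u (+) hit (asg X (val t)) (X (val t)) t v).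
(** [x] is the least radius with which [t] would hit an end. It depends on [al] alone, that is, on
    the rounds before [t], hence not on the coins of [t]. *)
Definition first_hit al x t := [&& both_free al, either_hit al x t &
  [forall y : 'I_x, ~~ either_hit al y t]].

Lemma touch_uniq X t t' : touch X t -> touch X t' -> t = t'.
Proof.
wlog tt' : t t' / (val t <= val t')%N.
  by move=> H tX t'X; have [/H|/ltnW/H] := leqP (val t) (val t'); [apply|move/(_ t'X tX)].
move: tt'; rewrite leq_eqVlt => /orP[/eqP/val_inj/val_inj //|tt'].
move=> /andP[_ h] /andP[/andP[/eqP u0 /eqP v0] _].
have mono w : asg X (val t') w = None -> asg X (val t).+1 w = None.
  by case E: (asg X (val t).+1 w) => [t1|//]; rewrite (asg_mono tt' E).
move: (mono _ u0) (mono _ v0); rewrite asgS /grow_step.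
by case/orP: h => ->.
Qed.

(** Non-terminal ends start free; as long as no round takes exactly one of two free ends, they stay
    both free or get the same value. *)
Lemma splits_exists X : asg X n u <> asg X n v -> u \notin K -> v \notin K ->
  exists t, splits X t.
Proof.
move=> neq uK vK.
suff H r : [\/ both_free (asg X r), asg X r u = asg X r v | exists t, splits X t].
  by case: (H n) => // /andP[/eqP u0 /eqP v0]; case: neq; rewrite u0 v0.
elim/(asg_ind X): r => [|r nt|t].
- have nK w : w \notin K -> asg X 0 w = None.
    by move=> wK; case E: (asg X 0 w) => [t|//]; move/asg0: E wK => ->; rewrite (valP t).
  by constructor 1; rewrite /both_free !nK.
- by rewrite asgSn.
have [bf _|nbf] := boolP (both_free (asg X (val t))).
  have [ct|nct] := boolP (splits X t); first by constructor 3; exists t.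
  move: nct; rewrite /splits bf andTb asgS.
  case hu: (hit _ _ _ u); case hv: (hit _ _ _ v) => //= _; first by constructor 2; rewrite /grow_step hu hv.
  by constructor 1; rewrite /both_free /grow_step hu hv.
case=> [//|eq|]; last by constructor 3.
constructor 2; rewrite asgS /grow_step /hit; move: nbf; rewrite /both_free eq andbb.
by move=> /negbTE ->.
Qed.

Lemma hit_other al x y t a b W : al (val t) = Some t -> e a b -> e b a ->
  lam a b = lam b a -> hit al x t a -> al b = None -> (x <= N.*2)%N ->
  (x + W <= y)%N -> (4 * N)%:R * lam a b <= W%:R * Dl b -> hit al y t b.
Proof.
move=> alt eab eba lab ha bN xN xWy Wb.
have xy : (x <= y)%N by apply: leq_trans xWy; exact: leq_addr.
apply: (hit_step (hit_mono Dl_ge0 xy ha) eab bN).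
have := hit_within alt ha; rewrite /in_reach => wa.
have Nd : N%:R * dl (val t) b <= N%:R * (dl (val t) a + lam a b).
  by rewrite ler_wpM2l // dl_edge.
have h1 : (N + x)%:R * Dl a <= (N + x)%:R * (Dl b + lam a b).
  by rewrite ler_wpM2l // lab Dl_edge.
(* Moving from [a] to [b] costs N times the length in [dl] and N + x times in [Dl]; with x at most 2
   N this gives the constant 4. *)
have h2 : (N + x + N)%:R * lam a b <= (4 * N)%:R * lam a b.
  by rewrite ler_wpM2r ?lam_ge0 // ler_nat; clear -xN; lia.
have h3 : (N + x + W)%:R * Dl b <= (N + y)%:R * Dl b.
  by rewrite ler_wpM2r // ler_nat -addnA leq_add2l.
rewrite !natrD in wa h1 h2 h3 *; lra.
Qed.

Lemma splits_first_hit X t W : (X (val t) <= N.*2)%N -> splits X t ->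
  (4 * N)%:R * lam u v <= W%:R * Dl u -> (4 * N)%:R * lam u v <= W%:R * Dl v ->
  exists x, [/\ first_hit (asg X (val t)) x t, (x <= X (val t))%N & (X (val t) < x + W)%N].
Proof.
move=> XN /andP[bf hX] Wu Wv.
have ex : exists x, either_hit (asg X (val t)) x t.
  by exists (X (val t)); rewrite /either_hit; move: hX; do 2 case: (hit _ _ _ _).
case: (ex_minnP ex) => x hx xmin; exists x.
have xX : (x <= X (val t))%N.
  by apply: xmin; rewrite /either_hit; move: hX; do 2 case: (hit _ _ _ _).
have xN : (x <= N.*2)%N by exact: leq_trans XN.
split => //.
  rewrite /first_hit bf hx; apply/forallP => y; apply/negP => /xmin.
  by rewrite leqNgt ltn_ord.
(* [W] grid steps beyond the first hit, the other end would be hit as well, and the round would not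
   split the edge. *)
rewrite ltnNge; apply/negP => xWX.
move/andP: bf => [/eqP u0 /eqP v0]; have at_ := asg_terminal X (val t) t.
move: hX; case/orP: hx => hx.
  by rewrite (hit_mono Dl_ge0 xX hx) (hit_other at_ euv evu lamC hx v0 xN xWX Wv).
rewrite (hit_mono Dl_ge0 xX hx) (hit_other at_ evu euv _ hx u0 xN xWX) //.
by rewrite -lamC.
Qed.

Lemma first_hit_touch X t x : first_hit (asg X (val t)) x t -> (x <= X (val t))%N ->
  touch X t.
Proof.
move=> /and3P[bf hx _] xX; rewrite /touch bf /=.
by case/orP: hx => /(hit_mono Dl_ge0 xX) hx; rewrite /either_hit hx ?orbT.
Qed.

Lemma first_hit_uniq al x y t : first_hit al x t -> first_hit al y t -> x = y.
Proof.
wlog xy : x y / (x <= y)%N.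
  by move=> H fx fy; have [/H|/ltnW/H ->] := leqP x y; [apply|by []..].
move=> /and3P[_ hx _] /and3P[_ _ /forallP ny]; apply/eqP; rewrite eqn_leq xy /=.
by rewrite leqNgt; apply/negP => xy'; have := ny (Ordinal xy'); rewrite hx.
Qed.

End Edge.
End Metric.
End Clustering.

(** * The probability of separating an edge *)

Lemma sum_uniq_le1 (I : finType) (P : pred I) :
  (forall i j, P i -> P j -> i = j) -> (\sum_i P i <= 1)%N.
Proof.
move=> Pu; have [[i Pi]|nP] := pselect (exists i, P i).
  rewrite (bigD1 i) //= Pi big1 // => j ji; case Pj: (P j) => //.
  by rewrite (Pu _ _ Pj Pi) eqxx in ji.
by rewrite big1 // => i _; case Pi: (P i) => //; case: nP; exists i.
Qed.

Lemma sum_exists (I : finType) (P : pred I) : (exists i, P i) -> (0 < \sum_i P i)%N.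
Proof. by case=> i Pi; rewrite (bigD1 i) //= Pi. Qed.

Section CutCount.
Context {R : realType} {n T : nat}.
Variables (e : rel 'I_n) (dl : 'I_n -> 'I_n -> R) (Dl : 'I_n -> R)
  (K : {set 'I_n}) (B : nat) (lam : 'I_n -> 'I_n -> R).
Hypotheses (B_gt0 : (0 < B)%N) (B_le : (B <= n)%N) (KB : (#|K| <= 2 ^ B)%N).
Hypothesis T_ge : (2 * (n * n) <= T)%N.
Hypothesis Dl_ge0 : forall u, 0 <= Dl u.
Hypothesis lam_ge0 : forall u v, e u v -> 0 <= lam u v.
Hypothesis dl_edge : forall w u v, e u v -> dl w v <= dl w u + lam u v.
Hypothesis Dl_edge : forall u v, e u v -> Dl v <= Dl u + lam u v.

(** The tape starts with two n by n blocks, one row per vertex, in the order in which the two calls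
    of [flip_rows] read it. *)
Definition geo_pos (j i : nat) : nat := j * n + i.
Definition unif_pos (j i : nat) : nat := n * n + (j * n + i).
Definition reach (w : T.-tuple bool) (j : 'I_n) : nat :=
  coin_value (geo_pos j) (unif_pos j) B n w.

Lemma reach_le w j : (reach w j <= (B * 2 ^ n).*2)%N.
Proof.
rewrite /reach /coin_value -addnn leq_add //.
  by rewrite leq_mul2r lead_le orbT.
apply: leq_trans (ltnW (horner2_lt _ _)) _.
by rewrite -[X in (X <= _)%N]mul1n leq_mul2r B_gt0 orbT.
Qed.

Lemma row_lt (j : 'I_n) i : (i < n)%N -> (j * n + i < n * n)%N.
Proof.
move=> i_n; apply: (@leq_trans (j * n + n)); first by rewrite ltn_add2l.
by rewrite -mulSnr leq_mul2r ltn_ord orbT.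
Qed.

Lemma row_inj (j j' : 'I_n) i i' : (i < n)%N -> (i' < n)%N ->
  (j * n + i)%N = (j' * n + i')%N -> j = j'.
Proof.
move=> i_n i'n E; apply/val_inj => /=.
have n0 : (0 < n)%N by lia.
by have := congr1 (divn^~ n) E; rewrite !divnMDl // !divn_small // !addn0.
Qed.

Lemma geo_ltT (j : 'I_n) i : (i < n)%N -> (geo_pos j i < T)%N.
Proof. by move=> /(row_lt j); rewrite /geo_pos; lia. Qed.

Lemma unif_ltT (j : 'I_n) i : (i < n)%N -> (unif_pos j i < T)%N.
Proof. by move=> /(row_lt j); rewrite /unif_pos; lia. Qed.

Lemma reach_geo_flip w (j j' : 'I_n) i : (i < B)%N -> j != j' ->
  reach (toggle (geo_pos j i) w) j' = reach w j'.
Proof.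
move=> iB jj'; have i_n : (i < n)%N by lia.
rewrite /reach /coin_value; congr (_ * _ + _)%N.
  apply: eq_lead => i' i'B; have i'n : (i' < n)%N by lia.
  rewrite nth_toggle ?geo_ltT //; case: eqP => [/esym/(row_inj i_n i'n) E|_]; last by rewrite addbF.
  by rewrite E eqxx in jj'.
apply: eq_horner2 => i' i'n; rewrite nth_toggle ?unif_ltT //.
by case: eqP => [|_]; [move: (row_lt j i_n); rewrite /geo_pos /unif_pos; lia|rewrite addbF].
Qed.

Lemma reach_unif_flip w (j j' : 'I_n) i : (i < n)%N -> j != j' ->
  reach (toggle (unif_pos j i) w) j' = reach w j'.
Proof.
move=> i_n jj'; rewrite /reach /coin_value; congr (_ * _ + _)%N.
  apply: eq_lead => i' i'B; have i'n : (i' < n)%N by lia.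
  rewrite nth_toggle ?geo_ltT //.
  by case: eqP => [|_]; [move: (row_lt j' i'n); rewrite /geo_pos /unif_pos; lia|rewrite addbF].
apply: eq_horner2 => i' i'n; rewrite nth_toggle ?unif_ltT //.
case: eqP => [/esym/addnI/(row_inj i_n i'n) E|_]; last by rewrite addbF.
by rewrite E eqxx in jj'.
Qed.

(** An event determined by the radii of earlier terminals ignores the coins in the rows of [t]. *)
Lemma cnt_reach (A : pred (T.-tuple bool)) (t : terminal K) x0 x : (x0 <= x)%N ->
  (forall w w', (forall j : 'I_n, (j < val t)%N -> reach w j = reach w' j) -> A w = A w') ->
  (2 ^ B * (2 ^ n * cnt (fun w => A w && (reach w (val t) == x))) <=
  2 ^ B * cnt (fun w => A w && (x0 <= reach w (val t))) + cnt A)%N.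
Proof.
move=> x0x At; apply: cnt_coin_value => // [i iB|i i_n|i j iB jB|i j i_n jn|i j iB jn|i iB w|i i_n w].
- by apply: geo_ltT; lia.
- exact: unif_ltT.
- by rewrite /geo_pos eqn_add2l.
- by rewrite /unif_pos !eqn_add2l.
- have i_n : (i < n)%N by lia.
  by move: (row_lt (val t) i_n); rewrite /geo_pos /unif_pos; lia.
- by apply: At => j jt; apply: reach_geo_flip => //; rewrite neq_ltn jt orbT.
- by apply: At => j jt; apply: reach_unif_flip => //; rewrite neq_ltn jt orbT.
Qed.

Section Edge.
Variables u v : 'I_n.
Hypotheses (euv : e u v) (evu : e v u) (lamC : lam u v = lam v u).
Hypotheses (uK : u \notin K) (vK : v \notin K).
Variable W : nat.
Let N := (B * 2 ^ n)%N.
Hypothesis Wu : (4 * N)%:R * lam u v <= W%:R * Dl u.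
Hypothesis Wv : (4 * N)%:R * lam u v <= W%:R * Dl v.

Let as_ (w : T.-tuple bool) := asg e dl Dl K N (reach w).
Let touch_ (w : T.-tuple bool) (t : terminal K) := touch e dl Dl N u v (reach w) t.

(** Each of the [W] grid points after the first hit x has mass bounded by the tail from x, and a
    radius at least x means that [t] touches the edge. Distinct x are disjoint events, so the
    truncation errors together contribute one [2 ^ T] per grid point. *)
Lemma cnt_cut (t : terminal K) :
  (2 ^ B * (2 ^ n * cnt (fun w => splits e dl Dl N u v (reach w) t)) <=
   W * (2 ^ B * cnt (fun w => touch_ w t) + 2 ^ T))%N.
Proof.
pose A (x : 'I_N.*2.+1) w := first_hit e dl Dl N u v (as_ w (val t)) x t.
(* Union bound over the first-hit radius x and the offset i of the actual radius from it. *)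
have step1 : (cnt (fun w => splits e dl Dl N u v (reach w) t) <=
   \sum_(x : 'I_N.*2.+1) \sum_(i < W) cnt (fun w => A x w && (reach w (val t) == x + i)))%N.
  rewrite pair_bigA /= /cnt exchange_big /=.
  apply: leq_sum => w _; case ct: (splits _ _ _ _ _ _ _ _) => //.
  have [x [fx xX Xx]] := splits_first_hit Dl_ge0 lam_ge0 dl_edge Dl_edge euv evu lamC
    (reach_le w _) ct Wu Wv.
  have xN : (x < N.*2.+1)%N by rewrite ltnS (leq_trans xX) ?reach_le.
  have iW : (reach w (val t) - x < W)%N by rewrite ltn_subLR.
  rewrite (bigD1 (Ordinal xN, Ordinal iW)) //=.
  by rewrite /A /= fx subnKC // eqxx.
apply: leq_trans (_ : (\sum_(x : 'I_N.*2.+1) \sum_(i < W)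
    (2 ^ B * cnt (fun w => A x w && (x <= reach w (val t))) + cnt (A x)) <= _)%N).
  apply: leq_trans (leq_mul (leqnn _) (leq_mul (leqnn _) step1)) _.
  rewrite big_distrr big_distrr /=; apply: leq_sum => x _; rewrite big_distrr big_distrr /=.
  apply: leq_sum => i _; apply: (@cnt_reach (A x)); first exact: leq_addr.
  by move=> w w' ww'; rewrite /A /as_ (@asg_ext _ _ _ _ _ _ _ (reach w) (reach w')).
under eq_bigr do rewrite sum_nat_const card_ord.
rewrite -big_distrr /= leq_mul2l; apply/orP; right; rewrite big_split /= leq_add //.
  rewrite -big_distrr /= leq_mul2l; apply/orP; right; rewrite /cnt exchange_big /=.
  apply: leq_sum => w _; case tw: (touch_ w t).
    apply: sum_uniq_le1 => x y /andP[ax _] /andP[ay _].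
    by apply/val_inj; exact: first_hit_uniq ax ay.
  rewrite big1 // => x _; case ax: (A x w) => //=; case: leqP => //= xr.
  by move: tw; rewrite /touch_ (first_hit_touch Dl_ge0 ax xr).
rewrite /cnt exchange_big /=; apply: leq_trans (_ : \sum_(w : T.-tuple bool) 1 <= _)%N.
  apply: leq_sum => w _; apply: sum_uniq_le1 => x y ax ay.
  by apply/val_inj; exact: first_hit_uniq ax ay.
by rewrite sum1_card card_tuple card_bool.
Qed.

(** The touching events are disjoint and the |K| truncation errors amount to at most [2 ^ B] by
    [KB]; these two equal contributions give the factor 2. *)
Lemma cnt_separated :
  (2 ^ n * cnt (fun w => as_ w n u != as_ w n v) <= 2 * W * 2 ^ T)%N.
Proof.
have step1 : (cnt (fun w => as_ w n u != as_ w n v) <=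
    \sum_(t : terminal K) cnt (fun w => splits e dl Dl N u v (reach w) t))%N.
  rewrite /cnt exchange_big /=; apply: leq_sum => w _.
  case: eqP => //= neq; apply: sum_exists.
  exact: (splits_exists neq uK vK).
rewrite -(@leq_pmul2l (2 ^ B)) ?expn_gt0 //.
apply: leq_trans (leq_mul (leqnn _) (leq_mul (leqnn _) step1)) _.
rewrite big_distrr big_distrr /=.
apply: (@leq_trans (\sum_(t : terminal K) W * (2 ^ B * cnt (fun w => touch_ w t) + 2 ^ T))%N).
  by apply: leq_sum => t _; exact: cnt_cut.
have -> : (2 ^ B * (2 * W * 2 ^ T) = W * (2 ^ B * 2 ^ T + 2 ^ B * 2 ^ T))%N by ring.
rewrite -big_distrr leq_mul2l; apply/orP; right; rewrite big_split /= leq_add //.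
  rewrite -big_distrr /= leq_mul2l; apply/orP; right; rewrite /cnt exchange_big /=.
  apply: leq_trans (_ : \sum_(w : T.-tuple bool) 1 <= _)%N.
    by apply: leq_sum => w _; apply: sum_uniq_le1 => t t'; exact: touch_uniq.
  by rewrite sum1_card card_tuple card_bool.
by rewrite sum_nat_const leq_mul2r card_sig KB orbT.
Qed.

End Edge.
End CutCount.

(** * Contraction of short edges and the expected stretch *)

Lemma expn2_ge n : (2 * n <= 2 ^ n)%N.
Proof.
elim: n => // n IH; case: n IH => // n IH; rewrite expnS.
have := leq_mul (leqnn 2) IH; lia.
Qed.

Section Contraction.
Context {R : realType} {n : nat}.
Variables (e : rel 'I_n) (l : 'I_n -> 'I_n -> R) (K : {set 'I_n}) (t0 : 'I_n).
Hypotheses (eC : symmetric e) (e_conn : forall u v, connect e u v).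
Hypothesis lC : forall u v, e u v -> l u v = l v u.
Hypothesis l_ge0 : forall u v, e u v -> 0 <= l u v.
Hypothesis t0K : t0 \in K.

Definition nearest (d : 'I_n -> 'I_n -> R) (u : 'I_n) : R :=
  d [arg min_(t < t0 in K) d t u]%O u.

Lemma nearest_le d t u : t \in K -> nearest d u <= d t u.
Proof. by rewrite /nearest; case: arg_minP => // s sK smin tK; exact: smin. Qed.

Lemma nearest_ex d u : exists2 t, t \in K & nearest d u = d t u.
Proof. by rewrite /nearest; case: arg_minP => // s sK _; exists s. Qed.

Let d := dist e l.
Let D := nearest d.

Definition contracted u v :=
  ((2 ^ n)%:R * l u v <= D u) && ((2 ^ n)%:R * l u v <= D v).

Definition clen u v : R := if contracted u v then 0 else l u v.

Let d' := dist e clen.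
Let D' := nearest d'.

Lemma clen_ge0 u v : e u v -> 0 <= clen u v.
Proof. by move=> euv; rewrite /clen; case: ifP => // _; exact: l_ge0. Qed.

Lemma clen_le u v : e u v -> clen u v <= l u v.
Proof. by move=> euv; rewrite /clen; case: ifP => // _; exact: l_ge0. Qed.

Lemma clenC u v : e u v -> clen u v = clen v u.
Proof. by move=> euv; rewrite /clen /contracted lC // andbC. Qed.

Lemma cdist_le u v : d' u v <= d u v.
Proof.
rewrite /d; have [p [pp lp _ <-]] := dist_attained l_ge0 e_conn u v.
apply: le_trans (dist_le clen_ge0 pp lp) _.
elim: p u pp {lp} => //= w p IH u /andP[euw pw].
by rewrite lerD ?clen_le ?IH.
Qed.

Lemma D'_ge0 u : 0 <= D' u.
Proof. by rewrite /D'; have [t _ ->] := nearest_ex d' u; apply: dist_ge0 => //; exact: clen_ge0. Qed.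

Lemma D'_terminal u : u \in K -> D' u = 0.
Proof.
move=> uK; apply/eqP; rewrite eq_le D'_ge0 andbT.
by apply: le_trans (nearest_le _ _ uK) _; rewrite /d' (distxx clen_ge0).
Qed.

Lemma d'_edge w u v : e u v -> d' w v <= d' w u + clen u v.
Proof. by apply: dist_edge => //; exact: clen_ge0. Qed.

Lemma D'_edge u v : e u v -> D' v <= D' u + clen u v.
Proof.
move=> euv; rewrite /D'; have [t tK ->] := nearest_ex d' u.
by apply: le_trans (nearest_le _ _ tK) _; exact: d'_edge.
Qed.

Lemma D'_le u : D' u <= D u.
Proof.
by rewrite /D /D'; have [t tK ->] := nearest_ex d u; apply: le_trans (nearest_le _ _ tK) (cdist_le _ _).
Qed.

(* On a walk from a terminal, every contracted edge has length at most
   [2 ^- n] times the length of the whole walk, and there are fewer than [n]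
   edges. *)
Lemma dist_le_cdist t u : t \in K -> d t u <= 2 * d' t u.
Proof.
move=> tK; have [p [pp lp sp wp]] := dist_attained clen_ge0 e_conn t u.
rewrite -/d' in wp.
set c := walk_length l t p.
have M0 : 0 < (2 ^ n)%:R :> R by rewrite ltr0n expn_gt0.
have c0 : 0 <= c by exact: walk_length_ge0 pp.
(* The premise keeps [d t a] at most [c]. The near end of a contracted edge then has [D] at most
   [c], which bounds the length removed by contracting it. *)
have H a q : path e a q -> d t a + walk_length l a q <= c ->
    (2 ^ n)%:R * walk_length l a q <= (2 ^ n)%:R * walk_length clen a q + (size q)%:R * c.
  elim: q a => [|b q IH] a /=; first by rewrite mulr0 mul0r addr0.
  move=> /andP[eab pq] ac.
  have db := dist_edge l_ge0 e_conn t eab; rewrite -/d in db.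
  have w0 := walk_length_ge0 l_ge0 pq.
  have h := IH b pq; have {}h := h _; rewrite -natr1 !mulrDr mulrDl mul1r.
  have ab : (2 ^ n)%:R * l a b <= (2 ^ n)%:R * clen a b + c.
    rewrite /clen; case: ifP => [/andP[la _]|_]; last by rewrite lerDl.
    rewrite mulr0 add0r; apply: le_trans la _; apply: le_trans (nearest_le _ _ tK) _.
    have := l_ge0 eab; rewrite -/d; lra.
  have : d t b + walk_length l b q <= c by lra.
  by move/h => {}h; lra.
have := H t p pp; rewrite -/c wp /d (distxx l_ge0) // add0r lexx => /(_ isT) h.
apply: le_trans (dist_le l_ge0 pp lp) _; rewrite -/c.
(* Hence the contracted edges account for at most half of [c], which is where the factor 2 comes
   from. *)
have sn : ((2 * size p)%N%:R : R) <= (2 ^ n)%:R.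
  rewrite ler_nat; apply: leq_trans (expn2_ge n); rewrite leq_mul2l /=.
  by apply: ltnW; rewrite card_ord in sp.
have h2 : (2 * size p)%N%:R * c <= (2 ^ n)%:R * c by rewrite ler_wpM2r.
rewrite -(ler_pM2l M0); rewrite natrM in h2; lra.
Qed.

End Contraction.

Section ExpectedStretch.
Context {R : realType} {n T : nat}.
Variables (e : rel 'I_n) (l : 'I_n -> 'I_n -> R) (K : {set 'I_n}) (t0 : terminal K) (B : nat).
Hypotheses (eC : symmetric e) (e_conn : forall u v, connect e u v).
Hypothesis lC : forall u v, e u v -> l u v = l v u.
Hypothesis l_ge0 : forall u v, e u v -> 0 <= l u v.
Hypotheses (B_gt0 : (0 < B)%N) (B_le : (B <= n)%N) (KB : (#|K| <= 2 ^ B)%N).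
Hypothesis T_ge : (2 * (n * n) <= T)%N.

Let lam := clen e l K (val t0).
Let dl := dist e lam.
Let Dl := nearest K (val t0) dl.
Let N := (B * 2 ^ n)%N.

Definition cluster_of (w : T.-tuple bool) : 'I_n -> option (terminal K) :=
  asg e dl Dl K N (reach B w) n.

(** The default [t0] is never taken, by [cluster_of_some]. *)
Definition zero_ext (w : T.-tuple bool) : {ffun 'I_n -> terminal K} :=
  [ffun u => odflt t0 (cluster_of w u)].

Let lam_ge0 u v : e u v -> 0 <= lam u v.
Proof. exact: clen_ge0. Qed.

Let Dl_ge0 u : 0 <= Dl u.
Proof. exact: (D'_ge0 e_conn l_ge0 (valP t0)). Qed.

Let dl_edge w u v : e u v -> dl w v <= dl w u + lam u v.
Proof. exact: d'_edge. Qed.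

Let Dl_edge u v : e u v -> Dl v <= Dl u + lam u v.
Proof. exact: (D'_edge e_conn l_ge0 (valP t0)). Qed.

Let dlxx u : dl u u = 0.
Proof. exact: distxx. Qed.

Lemma cluster_of_some w u : cluster_of w u = Some (zero_ext w u).
Proof.
have : cluster_of w u <> None.
  have DlK x : x \in K -> Dl x = 0 by move=> xK; exact: (D'_terminal e_conn l_ge0 (valP t0) xK).
  apply: (asg_total (lam := lam)) => //.
  have [t tK Dt] := nearest_ex (valP t0) dl u.
  have [p [pp lp _ wp]] := dist_attained lam_ge0 e_conn t u.
  by exists (Sub t tK), p; split => //; rewrite /Dl Dt.
by rewrite /zero_ext ffunE; case: (cluster_of w u).
Qed.

Lemma zero_ext_connected w : connected_0ext e (zero_ext w).
Proof.
split=> [x|x u v].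
  have := cluster_of_some w (val x); rewrite {1}/cluster_of asg_terminal.
  by case.
rewrite !inE => /eqP fu /eqP fv.
have to z : zero_ext w z = x -> connect
    [rel a b | [&& a \in [set y | zero_ext w y == x], b \in [set y | zero_ext w y == x] & e a b]]
    (val x) z.
  move=> fz; have := cluster_of_some w z; rewrite fz => /asg_fiber.
  apply: connect_sub => a b /and3P[/eqP ca /eqP cb eab]; apply: connect1.
  have [fa] : Some (zero_ext w a) = Some x by rewrite -cluster_of_some.
  have [fb] : Some (zero_ext w b) = Some x by rewrite -cluster_of_some.
  by rewrite /= !inE fa fb eqxx eab.
have sym : connect_sym
    [rel a b | [&& a \in [set y | zero_ext w y == x], b \in [set y | zero_ext w y == x] & e a b]].
  by apply: sym_connect_sym => a b; rewrite /= eC andbCA.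
by apply: connect_trans (to v fv); rewrite sym; exact: to.
Qed.

(** The constant is 2 for undoing the contraction times 3 for the largest radius. *)
Lemma dist_zero_ext w u : dist e l (val (zero_ext w u)) u <= 6 * Dl u.
Proof.
apply: le_trans (dist_le_cdist e_conn l_ge0 (valP t0) _ (valP _)) _.
have := asg_within Dl_ge0 dlxx (cluster_of_some w u).
rewrite /in_reach -/dl => h.
have N0 : 0 < N%:R :> R by rewrite ltr0n muln_gt0 B_gt0 expn_gt0.
have h2 : (N + reach B w (val (zero_ext w u)))%:R * Dl u <= (N * 3)%N%:R * Dl u.
  rewrite ler_wpM2r // ler_nat; have := reach_le B_gt0 w (val (zero_ext w u)).
  by rewrite -/N; lia.
rewrite natrM -mulrA in h2.
have := le_trans h h2; rewrite ler_pM2l // -/lam -/dl; lra.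
Qed.

Lemma dist_zero_ext_edge w u v : e u v ->
  dist e l (val (zero_ext w u)) (val (zero_ext w v)) <= 6 * Dl u + 6 * Dl v + l u v.
Proof.
move=> euv; apply: le_trans (dist_triangle l_ge0 e_conn v _ _) _.
have h1 := dist_edge l_ge0 e_conn (val (zero_ext w u)) euv.
have h2 := dist_zero_ext w u; have h3 := dist_zero_ext w v.
rewrite (distC l_ge0 e_conn _ (val (zero_ext w v)) eC lC); lra.
Qed.

Lemma sum_dist_le u v c : e u v -> 6 * Dl u + 6 * Dl v + l u v <= c ->
  \sum_(w : T.-tuple bool) dist e l (val (zero_ext w u)) (val (zero_ext w v)) <=
  (cnt (fun w => cluster_of w u != cluster_of w v))%:R * c.
Proof.
move=> euv hc; rewrite /cnt natr_sum mulr_suml; apply: ler_sum => w _.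
rewrite !cluster_of_some; case: eqP => [[->]|_] /=; first by rewrite (distxx l_ge0) // mul0r.
by rewrite mul1r; apply: le_trans hc; exact: dist_zero_ext_edge.
Qed.

(** With m the smaller of [Dl u] and [Dl v], the image distance is at most 12 m + 7 l(u,v), thus at
    most 19 times the larger of m and l(u,v). If l(u,v) is the larger, this suffices. Otherwise the
    separation probability is at most 2 W / 2^n with W m at most 5 B 2^n l(u,v), and 19 * 2 * 5 =
    190. *)
Lemma expected_edge u v : e u v ->
  \sum_(w : T.-tuple bool) dist e l (val (zero_ext w u)) (val (zero_ext w v)) <=
  190 * B%:R * l u v * 2 ^+ T.
Proof.
move=> euv; have evu : e v u by rewrite eC.
have l0 := l_ge0 euv; have lamC : lam u v = lam v u by exact: clenC.
have lam_l : lam u v <= l u v by exact: clen_le.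
have Duv := Dl_edge euv; have Dvu := Dl_edge evu; rewrite -lamC in Dvu.
have B1 : 1 <= B%:R :> R by rewrite ler1n.
have T0 : 0 < 2 ^+ T :> R by rewrite exprn_gt0.
have trivial_bound : 6 * Dl u + 6 * Dl v + l u v <= 19 * l u v ->
    \sum_(w : T.-tuple bool) dist e l (val (zero_ext w u)) (val (zero_ext w v)) <=
    190 * B%:R * l u v * 2 ^+ T.
  move=> h; apply: le_trans (sum_dist_le euv h) _.
  apply: le_trans (_ : 2 ^+ T * (19 * l u v) <= _).
    by rewrite ler_wpM2r ?mulr_ge0 // -natrX ler_nat cnt_le.
  rewrite mulrC ler_pM2r //.
  have : 1 * l u v <= B%:R * l u v by rewrite ler_wpM2r.
  by rewrite -mulrA; lra.
pose m := Num.min (Dl u) (Dl v).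
have mu : m <= Dl u by rewrite /m ge_min lexx.
have mv : m <= Dl v by rewrite /m ge_min lexx orbT.
have muv : Dl u + Dl v <= 2 * m + l u v
  by rewrite /m; case: (leP (Dl u) (Dl v)) => _; lra.
have [ml|lm] := lerP m (l u v); first by apply: trivial_bound; lra.
have m0 : 0 < m by exact: le_lt_trans l0 lm.
have nK x : 0 < Dl x -> x \notin K.
  by move=> Dx; apply/negP => xK; move: Dx; rewrite /Dl (D'_terminal e_conn l_ge0 (valP t0) xK) ?ltxx.
have uK := nK u (lt_le_trans m0 mu); have vK := nK v (lt_le_trans m0 mv).
have M0 : 0 < (2 ^ n)%:R :> R by rewrite ltr0n expn_gt0.
have [W [Wu Wv Wm]] : exists W, [/\ (4 * N)%:R * lam u v <= W%:R * Dl u,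
    (4 * N)%:R * lam u v <= W%:R * Dl v & W%:R * m <= 5 * B%:R * (2 ^ n)%:R * l u v].
  have Wmon (W : nat) x : m <= x -> W%:R * m <= W%:R * x by move=> mx; rewrite ler_wpM2l.
  have [lam0|lamn] := boolP (contracted e l K (val t0) u v).
    have -> : lam u v = 0 by rewrite /lam /clen lam0.
    (* A contracted edge has an empty window of separating radii. *)
    exists 0%N; rewrite !mulr0 !mul0r; split=> //.
    by rewrite !mulr_ge0.
  have lamE : lam u v = l u v by rewrite /lam /clen (negbTE lamn).
  have mM : m <= (2 ^ n)%:R * l u v.
    move: lamn; rewrite /contracted negb_and -!ltNge => /orP[]/ltW h.
      by apply: le_trans mu (le_trans (D'_le e_conn l_ge0 (valP t0) _) h).
    by apply: le_trans mv (le_trans (D'_le e_conn l_ge0 (valP t0) _) h).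
  (* Rounding x up to an integer costs at most m, which is at most [2 ^ n] times l(u,v) because the
     edge is not contracted; this raises the constant from 4 to 5. *)
  pose x := (4 * N)%:R * l u v / m.
  have x0 : 0 <= x by rewrite divr_ge0 ?mulr_ge0 // ltW.
  have xm : x * m = (4 * N)%:R * l u v by rewrite /x divfK // gt_eqF.
  have Wx : (4 * N)%:R * l u v <= (Num.truncn x).+1%:R * m.
    by rewrite -xm ler_wpM2r ?ltW // truncnS_gt.
  exists (Num.truncn x).+1; rewrite lamE; split.
  - exact: le_trans Wx (Wmon _ _ mu).
  - exact: le_trans Wx (Wmon _ _ mv).
  - have : (Num.truncn x)%:R * m <= x * m by rewrite ler_wpM2r ?truncn_le // ltW.
    have : 1 * ((2 ^ n)%:R * l u v) <= B%:R * ((2 ^ n)%:R * l u v).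
      by rewrite ler_wpM2r // mulr_ge0.
    rewrite xm /N natrM natrM -natr1 mulrDl mul1r; lra.
have cntW := cnt_separated B_gt0 B_le KB T_ge Dl_ge0 lam_ge0 dl_edge Dl_edge euv evu lamC uK vK Wu Wv.
rewrite -(ler_nat R) !natrM !natrX -/N in cntW.
have hc : 6 * Dl u + 6 * Dl v + l u v <= 19 * m by lra.
apply: le_trans (sum_dist_le euv hc) _.
rewrite -(ler_pM2l M0).
rewrite natrX in Wm *.
have h1 : 2 ^+ n * (cnt (fun w => cluster_of w u != cluster_of w v))%:R * m <= 2 * W%:R * 2 ^+ T * m.
  by rewrite ler_wpM2r // ltW.
have h2 : W%:R * m * 2 ^+ T <= 5 * B%:R * 2 ^+ n * l u v * 2 ^+ T.
  by rewrite ler_wpM2r // ltW.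
lra.
Qed.

End ExpectedStretch.

(** * The program *)

(* Arrays besides those of the input and output.  Natural: 5 and 6 hold the
   coins for g and U, row by terminal; 7 holds t+1 if the vertex is assigned to
   t and 0 if it is free; 8 is k, 9 a power of 2, 16 is B, 17 is g; 18 tells
   whether column v is in reach of row t; 10 to 13 are loop counters.  Real: 2
   and 3 are the lengths and the distances that are being computed, 4 is the
   distance to K; 6 and 7 are the two sides of the test for reach; 8 is an
   upper bound on all distances and 9 is scratch space. *)

Section LoopRules.
Context {R : realType}.
Implicit Types s : @state R.

Lemma den_seq n p q s : den n (PSeq p q) s = den n q (den n p s).
Proof. by []. Qed.

Lemma den_for_sum (get : state -> R) n (f : 'I_n -> R) v p s0 :
  (forall x s, get (set_var v x s) = get s) -> v \notin nwrites p ->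
  (forall (i : 'I_n) s, nmem s v 0 0 = i ->
    (forall a x y, a \notin v :: nwrites p -> nmem s a x y = nmem s0 a x y) ->
    (forall a x y, a \notin rwrites p -> rmem s a x y = rmem s0 a x y) ->
    get (den n p s) = get s + f i) ->
  get (den n (PFor v p) s0) = get s0 + \sum_i f i.
Proof.
move=> getv vp getp.
have -> : \sum_i f i = \sum_(i < n | (i < n)%N) f i.
  by rewrite [RHS](eq_bigl xpredT) // => i; rewrite ltn_ord.
apply: (den_for_ind (I := fun m s => get s = get s0 + \sum_(i < n | (i < m)%N) f i)) => //.
- by move=> m x s; rewrite getv.
- move=> i s sv f1 f2 h; rewrite (getp i) // h -addrA; congr (_ + _).
  rewrite [RHS](bigD1 i) //= addrC; congr (_ + _); apply: eq_bigl => j.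
  by rewrite ltnS andbC -ltn_neqAle.
- by rewrite big1 // addr0.
Qed.

Lemma den_for2_le (le : state -> state -> Prop) n (G : 'I_n -> 'I_n -> state -> Prop) v1 v2 p s0 :
  (forall s, le s s) -> (forall s1 s2 s3, le s1 s2 -> le s2 s3 -> le s1 s3) ->
  (forall x s, le s (set_var v1 x s)) -> (forall x s, le s (set_var v2 x s)) ->
  (forall i j s s', G i j s -> le s s' -> G i j s') ->
  wf (PFor v1 (PFor v2 p)) -> v2 \notin nwrites p ->
  (forall (i j : 'I_n) s, nmem s v1 0 0 = i -> nmem s v2 0 0 = j ->
    (forall a x y, a \notin [:: v1, v2 & nwrites p] -> nmem s a x y = nmem s0 a x y) ->
    (forall a x y, a \notin rwrites p -> rmem s a x y = rmem s0 a x y) ->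
    le s0 s -> le s (den n p s) /\ G i j (den n p s)) ->
  le s0 (den n (PFor v1 (PFor v2 p)) s0) /\
  forall i j, G i j (den n (PFor v1 (PFor v2 p)) s0).
Proof.
move=> lexx letr lev1 lev2 Gle /andP[v1p _] v2p Ib.
apply: (den_for_le (G := fun i s => forall j, G i j s)) => //.
  by move=> i s s' Gs ss' j; apply: Gle ss'.
move=> i s sv1 f1 f2 ls.
apply: den_for_le => // [j s1 s2|j s1 sv2 f3 f4 ls1]; first exact: Gle.
apply: Ib => //.
- by rewrite f3.
- move=> a x y; rewrite inE negb_or => /andP[av1 av2]; rewrite f3 ?f1 //.
  by rewrite inE negb_or av1.
- by move=> a x y ap; rewrite f4 ?f2.
- exact: letr ls1.
Qed.

Lemma den_fill (X : Type) (get : state -> nat -> X) n (g : 'I_n -> X) v p s0 :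
  (forall x s, get (set_var v x s) = get s) -> v \notin nwrites p ->
  (forall (i : 'I_n) s, nmem s v 0 0 = i ->
    (forall a x y, a \notin v :: nwrites p -> nmem s a x y = nmem s0 a x y) ->
    (forall a x y, a \notin rwrites p -> rmem s a x y = rmem s0 a x y) ->
    get (den n p s) i = g i /\ forall i' : nat, i' <> i -> get (den n p s) i' = get s i') ->
  forall i : 'I_n, get (den n (PFor v p) s0) i = g i.
Proof.
move=> getv vp getp.
have [] // := @den_for_le _ (fun s s' => forall i : 'I_n, get s' i = get s i \/ get s' i = g i)
  n (fun i s => get s i = g i) v p s0.
- by move=> s i; left.
- by move=> s1 s2 s3 h1 h2 i; case: (h2 i) => ->; [exact: h1|right].
- by move=> x s i; rewrite getv; left.
- by move=> i s s' si /(_ i) [->|->].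
- move=> i s sv f1 f2 _; have [h1 h2] := getp i s sv f1 f2; split => // i'.
  have [->|/eqP ii'] := eqVneq i' i; first by right.
  by left; apply: h2 => E; apply/ii'/val_inj.
Qed.

Lemma den_fill2 (X : Type) (get : state -> nat -> nat -> X) n (g : 'I_n -> 'I_n -> X) v1 v2 p s0 :
  (forall x s, get (set_var v1 x s) = get s) ->
  (forall x s, get (set_var v2 x s) = get s) ->
  wf (PFor v1 (PFor v2 p)) -> v2 \notin nwrites p ->
  (forall (i j : 'I_n) s, nmem s v1 0 0 = i -> nmem s v2 0 0 = j ->
    (forall a x y, a \notin [:: v1, v2 & nwrites p] -> nmem s a x y = nmem s0 a x y) ->
    (forall a x y, a \notin rwrites p -> rmem s a x y = rmem s0 a x y) ->
    get (den n p s) i j = g i j /\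
    forall i' j' : nat, ~ (i' = i /\ j' = j) -> get (den n p s) i' j' = get s i' j') ->
  forall i j : 'I_n, get (den n (PFor v1 (PFor v2 p)) s0) i j = g i j.
Proof.
move=> getv1 getv2 wfp v2p getp.
have [] // := @den_for2_le (fun s s' => forall i j : 'I_n, get s' i j = get s i j \/ get s' i j = g i j)
  n (fun i j s => get s i j = g i j) v1 v2 p s0.
- by move=> s i j; left.
- by move=> s1 s2 s3 h1 h2 i j; case: (h2 i j) => ->; [exact: h1|right].
- by move=> x s i j; rewrite getv1; left.
- by move=> x s i j; rewrite getv2; left.
- by move=> i j s s' si /(_ i j) [->|->].
- move=> i j s sv1 sv2 f1 f2 _; have [h1 h2] := getp i j s sv1 sv2 f1 f2; split => // i' j'.
  have [[-> ->]|ij] := pselect (i' = i /\ j' = j); first by right.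
  by left; apply: h2 => -[ii jj]; apply: ij; split; apply/val_inj.
Qed.

End LoopRules.

Notation lit := NConst.
Notation vec a i := (NGet a (scal i) (lit 0)).
Notation mat a i j := (NGet a (scal i) (scal j)).
Notation rscal a := (RGet a (lit 0) (lit 0)).
Notation rvec a i := (RGet a (scal i) (lit 0)).
Notation rmat a i j := (RGet a (scal i) (scal j)).

Infix ";;" := PSeq (at level 60, right associativity).

Definition flip_rows a := PFor 10 (PFor 11 (PFlip a (scal 10) (scal 11))).

Definition copy a b := PFor 10 (PFor 11 (PR b (scal 10) (scal 11) (rmat a 10 11))).

(** Serves as infinity for [relax]: n times the sum of all lengths bounds every walk of fewer than n
    edges. Real constants do not exist in the language, so 0 is written as a difference. *)
Definition total_length :=
  PR 8 (lit 0) (lit 0) (RSub (rscal 8) (rscal 8)) ;;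
  PFor 12 (PFor 10 (PFor 11 (PR 8 (lit 0) (lit 0) (RAdd (rscal 8) (rmat 2 10 11))))).

(** One Bellman-Ford round, in place and for all sources. *)
Definition relax :=
  PFor 10 (PFor 11 (PFor 12
    (PIf (TAnd (NLe (lit 1) (mat 1 12 11))
               (RLe (RAdd (rmat 3 10 12) (rmat 2 12 11)) (rmat 3 10 11)))
       (PR 3 (scal 10) (scal 11) (RAdd (rmat 3 10 12) (rmat 2 12 11))) PSkip))).

Definition all_distances :=
  total_length ;;
  PFor 10 (PFor 11 (PR 3 (scal 10) (scal 11) (rscal 8))) ;;
  PFor 10 (PR 3 (scal 10) (scal 10) (RSub (rscal 8) (rscal 8))) ;;
  PFor 13 relax.

Definition nearest_terminals :=
  PFor 10
    (PR 4 (scal 10) (lit 0) (rscal 8) ;;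
     PFor 11
       (PIf (TAnd (NLe (lit 1) (mat 2 11 11)) (RLe (rmat 3 11 10) (rvec 4 10)))
          (PR 4 (scal 10) (lit 0) (rmat 3 11 10)) PSkip)).

Definition contract_edges :=
  PFor 10 (PFor 11
    (PR 9 (lit 0) (lit 0) (rmat 0 10 11) ;;
     PFor 12 (PR 9 (lit 0) (lit 0) (RAdd (rscal 9) (rscal 9))) ;;
     PIf (TAnd (RLe (rscal 9) (rvec 4 10)) (RLe (rscal 9) (rvec 4 11)))
       (PR 2 (scal 10) (scal 11) (RSub (rscal 9) (rscal 9)))
       (PR 2 (scal 10) (scal 11) (rmat 0 10 11)))).

Definition log_terminals :=
  PFor 10 (PIf (NLe (lit 1) (mat 2 10 10)) (PN 8 (lit 0) (lit 0) (NAdd (scal 8) (lit 1))) PSkip) ;;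
  PN 9 (lit 0) (lit 0) (lit 1) ;;
  PFor 10
    (PIf (NLe (scal 8) (scal 9)) PSkip
       (PN 9 (lit 0) (lit 0) (NAdd (scal 9) (scal 9)) ;;
        PN 16 (lit 0) (lit 0) (NAdd (scal 16) (lit 1)))).

(** * Correctness of distances, contraction, logarithm and coin reading *)

Section Pieces.
Context {R : realType} {n : nat}.
Variables (e : rel 'I_n) (K : {set 'I_n}).
Hypothesis e_conn : forall u v, connect e u v.
Implicit Types s : @state R.

Definition has_adj s := forall u v : 'I_n, nmem s 1 u v = e u v.
Definition has_terminals s := forall u : 'I_n, nmem s 2 u u = (u \in K).

Lemma den_copy a b s (u v : 'I_n) : a != b ->
  rmem (den n (copy a b) s) b u v = rmem s a u v.
Proof.
move=> ab; apply: (den_fill2 (get := fun s => rmem s b) (g := fun i j => rmem s a i j)) => //.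
move=> i j s1 si sj _ f2; split => /=.
  by rewrite /upd si sj !eqxx /= f2 // inE.
move=> i' j' ij; rewrite /upd si sj eqxx /=.
by case: eqP => //= ii; case: eqP => //= jj; case: ij.
Qed.

Section Distances.
Variable len : 'I_n -> 'I_n -> R.
Hypothesis len_ge0 : forall u v, 0 <= len u v.
Let d := dist e len.

Lemma den_total_length s : (forall u v : 'I_n, rmem s 2 u v = len u v) ->
  forall u v : 'I_n, d u v <= rmem (den n total_length s) 8 0 0.
Proof.
move=> slen u v; rewrite /total_length /=; set s0 := State _ _ _.
have s0len (i j : 'I_n) : rmem s0 2 i j = len i j by rewrite /= /upd /= slen.
pose body := PR 8 (lit 0) (lit 0) (RAdd (rscal 8) (rmat 2 10 11)).
rewrite -[iteri n _ _]/(den n (PFor 12 (PFor 10 (PFor 11 body))) s0).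
pose S := \sum_(i < n) \sum_(j < n) len i j.
have -> : rmem (den n (PFor 12 (PFor 10 (PFor 11 body))) s0) 8 0 0 =
    rmem s0 8 0 0 + \sum_(x < n) S.
  apply: (den_for_sum (get := fun s => rmem s 8 0 0)) => // x s1 _ _ f1.
  apply: (den_for_sum (get := fun s => rmem s 8 0 0)) => // i s2 si _ f2.
  apply: (den_for_sum (get := fun s => rmem s 8 0 0)) => // j s3 sj f3 f4.
  by rewrite /= /upd /= (f3 10%N) // si sj (f4 2%N) // (f2 2%N) // (f1 2%N) // s0len.
have -> : rmem s0 8 0 0 = 0 by rewrite /= /upd /= subrr.
rewrite add0r sumr_const card_ord -mulr_natl.
have [p [pp lp sp wp]] := dist_attained (fun a b _ => len_ge0 a b) e_conn u v.
rewrite /d -wp.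
have lenS a b : len a b <= S.
  rewrite /S (bigD1 a) //= (bigD1 b) //= -addrA lerDl addr_ge0 ?sumr_ge0 // => i _.
  by rewrite sumr_ge0.
have S0 : 0 <= S by rewrite sumr_ge0 // => i _; rewrite sumr_ge0.
apply: le_trans (_ : (size p)%:R * S <= _).
  elim: p u {pp lp sp wp} => [|a p IH] u /=; first by rewrite mul0r.
  by rewrite -natr1 mulrDl mul1r addrC lerD.
by rewrite ler_wpM2r // ler_nat; rewrite card_ord in sp; exact: ltnW.
Qed.

(** Entries only decrease during the round and stay above the distance, so relaxing with current
    entries is at least as good as with those at the start of the round. *)
Lemma den_relax s : has_adj s -> (forall u v : 'I_n, rmem s 2 u v = len u v) ->
  (forall u v : 'I_n, d u v <= rmem s 3 u v) ->
  (forall u v : 'I_n, d u v <= rmem (den n relax s) 3 u v <= rmem s 3 u v) /\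
  forall u v x : 'I_n, e x v ->
    rmem (den n relax s) 3 u v <= rmem s 3 u x + len x v.
Proof.
move=> sadj slen sd.
pose le s1 s2 := forall u v : 'I_n, d u v <= rmem s1 3 u v ->
  d u v <= rmem s2 3 u v <= rmem s1 3 u v.
pose G3 (i j m : 'I_n) s1 := e m j -> rmem s1 3 i j <= rmem s 3 i m + len m j.
have lerr s1 : le s1 s1 by move=> u v ->; rewrite lexx.
have letr s1 s2 s3 : le s1 s2 -> le s2 s3 -> le s1 s3.
  move=> h1 h2 u v /(h1 u v)/andP[a b]; have /andP[c f] := h2 u v a.
  by rewrite c (le_trans f).
have G3le s1 s2 i j m : le s s1 -> G3 i j m s1 -> le s1 s2 -> G3 i j m s2.
  move=> l1 g l2 emj; apply: le_trans (g emj).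
  by have /andP[_ ->] := l2 i j (proj1 (andP (l1 i j (sd i j)))).
pose G (i j : 'I_n) s1 := le s s1 /\ forall m, G3 i j m s1.
have [] // := @den_for2_le _ le n G 10 11
  (PFor 12
    (PIf (TAnd (NLe (lit 1) (mat 1 12 11))
               (RLe (RAdd (rmat 3 10 12) (rmat 2 12 11)) (rmat 3 10 11)))
       (PR 3 (scal 10) (scal 11) (RAdd (rmat 3 10 12) (rmat 2 12 11))) PSkip)) s.
- move=> i j s1 s2 [l1 g1] l2; split; first exact: letr l2.
  by move=> m; apply: G3le l2.
- move=> i j s1 si sj f1 f2 ls1.
  set body := PIf _ _ _.
  have [] := @den_for_le _ le n (fun m s2 => le s s2 /\ G3 i j m s2) 12 body s1 => //.
  + move=> m s2 s3 [l2 g2] l3; split; first exact: letr l3.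
    exact: G3le l3.
  + move=> m s2 sm f3 f4 ls12.
    have ls2 : le s s2 by exact: letr ls12.
    have dim := andP (ls2 i m (sd i m)); have dij := andP (ls2 i j (sd i j)).
    have E1 : nmem s2 1 m j = e m j by rewrite f3 // f1 // sadj.
    have E2 : rmem s2 2 m j = len m j by rewrite f4 // f2 // slen.
    have F10 : nmem s2 10 0 0 = i by rewrite f3.
    have F11 : nmem s2 11 0 0 = j by rewrite f3.
    suff [h1 h2] : le s2 (den n body s2) /\ G3 i j m (den n body s2).
      by split => //; split => //; exact: letr h1.
    rewrite /= F10 F11 sm E1 E2.
    have [emj|nemj] := boolP (e m j); last by rewrite /=; split => //; rewrite /G3 (negbTE nemj).
    rewrite /=; case: leP => [le3|lt3]; last first.
      split => // _; apply: le_trans (ltW lt3) _; rewrite lerD2r; exact: dim.2.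
    split.
      move=> u v duv; rewrite /= /upd /=.
      case: eqP => [/val_inj uu|_] /=; last by rewrite duv lexx.
      case: eqP => [/val_inj vv|_] /=; last by rewrite duv lexx.
      rewrite uu vv le3 andbT; apply: le_trans (dist_edge _ e_conn i emj) _ => //.
      by rewrite lerD2r dim.1.
    by move=> _; rewrite /= /upd !eqxx /= lerD2r; exact: dim.2.
  by move=> h1 h2; split => //; split => [|m]; [exact: letr h1|exact: (h2 m).2].
move=> h1 h2; split => [u v|u v x]; first exact: h1.
exact: (h2 u v).2.
Qed.

Lemma den_all_distances s : has_adj s -> (forall u v : 'I_n, rmem s 2 u v = len u v) ->
  forall u v : 'I_n, rmem (den n all_distances s) 3 u v = d u v /\
    d u v <= rmem (den n all_distances s) 8 0 0.
Proof.
move=> sadj slen u v; rewrite /all_distances.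
set p1 := total_length; set p2 := PFor 10 (PFor 11 _); set p3 := PFor 10 (PR _ _ _ _).
rewrite -[den n _ s]/(den n (PFor 13 relax) (den n p3 (den n p2 (den n p1 s)))).
set s1 := den n p1 s; set s2 := den n p2 s1; set s3 := den n p3 s2.
have S1 := den_total_length slen; rewrite -/p1 -/s1 in S1.
have S2 (i j : 'I_n) : rmem s2 3 i j = rmem s1 8 0 0.
  apply: (den_fill2 (get := fun s => rmem s 3) (g := fun i j => rmem s1 8 0 0)) => //.
  move=> a b s' sa sb _ f2; split => /=; first by rewrite /upd sa sb !eqxx /= f2.
  move=> a' b' ab; rewrite /upd sa sb eqxx /=.
  by case: eqP => //= ea; case: eqP => //= eb; case: ab.
have S3 (i j : 'I_n) : rmem s3 3 i j = if i == j then 0 else rmem s1 8 0 0.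
  have [<-|ij] := eqVneq i j.
    apply: (den_fill (get := fun s x => rmem s 3 x x) (g := fun i => 0)) => //.
    move=> a s' sa _ f2; split => /=; first by rewrite /upd sa !eqxx /= subrr.
    by move=> a' aa; rewrite /upd sa eqxx /=; case: eqP.
  rewrite -(S2 i j); have [] // := @den_for_le _ (fun s s' => rmem s' 3 i j = rmem s 3 i j) n
    (fun _ _ => True) 10 (PR 3 (scal 10) (scal 10) (RSub (rscal 8) (rscal 8))) s2.
  - by move=> ? ? ? h1 h2; rewrite h2.
  - move=> a s' sa _ _ _; split => //=; rewrite /upd sa /=.
    case: eqP => //= ia; case: eqP => //= ja; case/eqP: ij; apply/val_inj; exact: etrans (esym ja).
have -> : rmem (den n (PFor 13 relax) s3) 8 0 0 = rmem s1 8 0 0 by rewrite den_rmem // /s3 den_rmem // /s2 den_rmem.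
suff H : (forall u v : 'I_n, d u v <= rmem (den n (PFor 13 relax) s3) 3 u v) /\
    forall (u : 'I_n) p, (size p <= n)%N -> path e u p ->
      rmem (den n (PFor 13 relax) s3) 3 u (last u p) <= walk_length len u p.
  split; last exact: S1.
  have [p [pp lp sp wp]] := dist_attained (fun a b _ => len_ge0 a b) e_conn u v.
  apply/eqP; rewrite eq_le H.1 andbT /d -wp -lp; apply: H.2 => //.
  by rewrite card_ord in sp; exact: ltnW.
(* After [r] rounds an entry is at most the length of any walk with at most [r] edges; n rounds
   cover a shortest walk. *)
pose I r s' := (forall u v : 'I_n, d u v <= rmem s' 3 u v) /\
  forall (u : 'I_n) p, (size p <= r)%N -> path e u p ->
    rmem s' 3 u (last u p) <= walk_length len u p.
apply: (den_for_ind (I := I)) => //.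
- move=> r s' _ f1 f2 [i1 i2].
  have adj' : has_adj s'.
    by move=> a b; rewrite f1 // !den_nmem.
  have len' (a b : 'I_n) : rmem s' 2 a b = len a b.
    by rewrite f2 // !den_rmem.
  have [h1 h2] := den_relax adj' len' i1.
  split=> [a b|a p]; first by have /andP[] := h1 a b.
  elim/last_ind: p => [_ _|p x _].
    apply: le_trans (i2 a [::] _ _) => //=; by have /andP[] := h1 a a.
  rewrite size_rcons ltnS rcons_path last_rcons => sp /andP[pp ex].
  apply: le_trans (h2 _ _ _ ex) _; rewrite -cats1 walk_length_cat /= addr0 lerD2r.
  exact: i2.
- split=> [a b|a [|//] _ _] /=; last by rewrite S3 eqxx.
  by rewrite S3; case: eqP => [->|_]; [rewrite /d distxx|exact: S1].
Qed.

End Distances.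

Lemma den_nearest s (dl : 'I_n -> 'I_n -> R) (t0 : 'I_n) :
  t0 \in K -> has_terminals s -> (forall u v : 'I_n, rmem s 3 u v = dl u v) ->
  (forall u v : 'I_n, dl u v <= rmem s 8 0 0) ->
  forall u : 'I_n, rmem (den n nearest_terminals s) 4 u 0 = nearest K t0 dl u.
Proof.
move=> t0K sK sd s8.
apply: (den_fill (get := fun s x => rmem s 4 x 0)) => // u s1 su f1 f2.
rewrite den_seq; set s2 := den n (PR _ _ _ _) s1; set body := PIf _ _ _.
pose I m s' := [/\ forall x, x <> u :> nat -> rmem s' 4 x 0 = rmem s1 4 x 0,
  nearest K t0 dl u <= rmem s' 4 u 0 &
  forall t : 'I_n, (t < m)%N -> t \in K -> rmem s' 4 u 0 <= dl t u].
have [] // : I n (den n (PFor 11 body) s2).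
  apply: (den_for_ind (I := I)) => //.
  - move=> t s3 st f3 f4 [i1 i2 i3].
    have F10 : nmem s3 10 0 0 = u by rewrite f3 //= su.
    have E2 : nmem s3 2 t t = (t \in K) by rewrite f3 //= f1 // sK.
    have E3 : rmem s3 3 t u = dl t u by rewrite f4 // /s2 /= /upd /= f2 // sd.
    rewrite /= F10 st E2 E3; have [tK|tK] := boolP (t \in K); last first.
      split=> // t'; rewrite ltnS leq_eqVlt => /orP[/eqP/val_inj ->|]; last exact: i3.
      by rewrite (negbTE tK).
    rewrite /=; case: leP => [le3|lt3]; last first.
      split=> // t'; rewrite ltnS leq_eqVlt => /orP[/eqP/val_inj -> _|]; last exact: i3.
      exact: ltW.
    split=> [x xu| |t'] /=; rewrite /upd /= ?eqxx /=.
    + by case: eqP => //= _; exact: i1.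
    + exact: nearest_le.
    + rewrite ltnS leq_eqVlt => /orP[/eqP/val_inj -> //|h h']; apply: le_trans le3 _.
      exact: i3.
  - split=> [x xu| |//]; rewrite /= /upd /= su ?eqxx /=; first by case: eqP.
    by have [t tK ->] := nearest_ex t0K dl u; rewrite f2.
move=> h1 h2 h3; split; last exact: h1.
apply/eqP; rewrite eq_le h2 andbT; have [t tK ->] := nearest_ex t0K dl u.
exact: h3.
Qed.

Lemma den_contract_edges s (l : 'I_n -> 'I_n -> R) (t0 : 'I_n) :
  (forall u v : 'I_n, rmem s 0 u v = l u v) ->
  (forall u : 'I_n, rmem s 4 u 0 = nearest K t0 (dist e l) u) ->
  forall u v : 'I_n, rmem (den n contract_edges s) 2 u v = clen e l K t0 u v.
Proof.
move=> sl sD; apply: (den_fill2 (get := fun s => rmem s 2)) => // u v s1 su sv f1 f2.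
rewrite !den_seq; set s2 := den n (PR _ _ _ _) s1; set s3 := den n (PFor _ _) s2.
have s39 : rmem s3 9 0 0 = (2 ^ n)%:R * l u v.
  apply: (den_for_ind (I := fun m s => rmem s 9 0 0 = (2 ^ m)%:R * l u v)) => //.
    by move=> m s' _ _ _ E; rewrite /= /upd /= E expnS mul2n -addnn natrD mulrDl.
  by rewrite /= /upd /= su sv f2 // sl mul1r.
have s3u : nmem s3 10 0 0 = u by rewrite /s3 den_nmem.
have s3v : nmem s3 11 0 0 = v by rewrite /s3 den_nmem.
have s34 (x : 'I_n) : rmem s3 4 x 0 = nearest K t0 (dist e l) x by rewrite /s3 den_rmem // /s2 /= /upd /= f2.
have s30 : rmem s3 0 u v = l u v by rewrite /s3 den_rmem // /s2 /= /upd /= f2.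
have s32 i j : rmem s3 2 i j = rmem s1 2 i j by rewrite /s3 den_rmem.
have s4 : (if teval s3 (TAnd (RLe (rscal 9) (rvec 4 10)) (RLe (rscal 9) (rvec 4 11))) then
    State (nmem s3) (upd (rmem s3) 2 u v 0) (coins s3) else
    State (nmem s3) (upd (rmem s3) 2 u v (l u v)) (coins s3)) =
    State (nmem s3) (upd (rmem s3) 2 u v (clen e l K t0 u v)) (coins s3).
  rewrite /= s3u s3v s39 !s34 /clen /contracted.
  by case: ifP.
have -> : den n (PIf (TAnd (RLe (rscal 9) (rvec 4 10)) (RLe (rscal 9) (rvec 4 11)))
       (PR 2 (scal 10) (scal 11) (RSub (rscal 9) (rscal 9)))
       (PR 2 (scal 10) (scal 11) (rmat 0 10 11))) s3 =
    State (nmem s3) (upd (rmem s3) 2 u v (clen e l K t0 u v)) (coins s3).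
  by rewrite -s4 /= s3u s3v s30 subrr.
split=> [|i j ij]; rewrite /= /upd !eqxx //=.
by case: eqP => //= ii; case: eqP => //= jj; case: ij.
Qed.

Lemma den_log_terminals s : has_terminals s -> nmem s 8 0 0 = 0%N -> nmem s 16 0 0 = 0%N ->
  (1 < #|K|)%N -> nmem (den n log_terminals s) 16 0 0 = up_log 2 #|K|.
Proof.
move=> sK s8 s16 K1; rewrite /log_terminals !den_seq.
set s1 := den n (PFor 10 _) s; set s2 := den n (PN _ _ _ _) s1; set body := PIf _ _ _.
have s18 : nmem s1 8 0 0 = #|K|.
  (* The count is cast to [R] because [den_for_sum] is about real observables. *)
  apply/eqP; rewrite -(eqr_nat R) /s1; apply/eqP.
  rewrite (@den_for_sum R (fun s => (nmem s 8 0 0)%:R) n (fun i => (i \in K)%:R)) //.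
    by rewrite s8 add0r -sum1_card natr_sum [RHS]big_mkcond /=; apply: eq_bigr => i _; case: ifP.
  move=> i s' si f1 _; rewrite /= si f1 // sK.
  by case: (i \in K); rewrite /= /upd /= ?addr0 // natrD.
set L := up_log 2 _.
have Ln : (L <= n)%N.
  apply: up_log_min => //; apply: leq_trans (_ : n <= _)%N.
    by rewrite -[X in (_ <= X)%N]card_ord max_card.
  exact: ltnW (ltn_expl _ _).
(* The power of 2 doubles until it reaches the number of terminals, after [L] rounds, and then the
   loop idles. *)
pose I m s' := [/\ nmem s' 8 0 0 = #|K|, nmem s' 9 0 0 = (2 ^ minn m L)%N &
  nmem s' 16 0 0 = minn m L].
suff [_ _ ->] : I n (den n (PFor 10 body) s2) by rewrite (minn_idPr Ln).
apply: (den_for_ind (I := I)) => //.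
- move=> i s' si f1 f2 [i1 i2 i3]; rewrite /= i1 i2; have [Li|iL] := leqP L i.
    by rewrite up_logP //=; split; rewrite ?i1 ?i2 ?i3 ?(minn_idPr Li) ?(minn_idPr (leqW Li)).
  rewrite ifF; last first.
    by apply/negbTE/negP => /(up_log_min (isT : 1 < 2)%N); rewrite -/L leqNgt iL.
  rewrite /I (minn_idPl iL) /= /upd /= i1 ?i2 i3 ?(minn_idPl (ltnW iL)) expnS mul2n addnn addn1.
  by split.
- split; [exact: s18|by rewrite min0n|].
  by rewrite min0n; apply: etrans s16; rewrite -[LHS]/(nmem s1 16 0 0) /s1 den_nmem.
Qed.

Lemma den_flip_rows a s : a != 10%N -> a != 11%N ->
  (forall i j : 'I_n, nmem (den n (flip_rows a) s) a i j = nth false (coins s) (i * n + j)%N) /\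
  coins (den n (flip_rows a) s) = drop (n * n)%N (coins s).
Proof.
move=> a10 a11; have a10' := negbTE a10; have a11' := negbTE a11.
pose I i s' := coins s' = drop (i * n)%N (coins s) /\ forall x y, (x < i)%N -> (y < n)%N ->
  nmem s' a x y = nth false (coins s) (x * n + y)%N.
have [h1 h2] : I n (den n (flip_rows a) s).
  apply: (den_for_ind (I := I)).
  - by move=> m x s' [i1 i2]; split => // *; rewrite /= /upd a10' /= i2.
  - by rewrite /= !inE (eq_sym 10%N a) a10'.
  - move=> i s1 si _ _ [c1 b1].
    pose J j s' := [/\ coins s' = drop (i * n + j)%N (coins s),
      forall x y, (x < i)%N -> (y < n)%N -> nmem s' a x y = nth false (coins s) (x * n + y)%N &
      forall y, (y < j)%N -> nmem s' a i y = nth false (coins s) (i * n + y)%N].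
    have [j1 j2 j3] : J n (den n (PFor 11 (PFlip a (scal 10) (scal 11))) s1).
      apply: (den_for_ind (I := J)).
      + by move=> m x s' [i1 i2 i3]; split => // [x1 y xi yn|y ym]; rewrite /= /upd a11' /=; [exact: i2|exact: i3].
      + by rewrite /= !inE (eq_sym 11%N a) a11'.
      + move=> j s2 sj f1 _ [c2 b2 b3].
        have F10 : nmem s2 10 0 0 = i by rewrite f1 // !inE (eq_sym 10%N a) a10'.
        split=> [|x y xi yn|y] /=; rewrite ?F10 ?sj ?c2.
        * by rewrite -drop1 drop_drop add1n addnS.
        * by rewrite /upd eqxx /= (ltn_eqF xi) /= b2.
        * rewrite /upd !eqxx /= ltnS leq_eqVlt; case: eqP => [-> _|_ /= /b3 //].
          by rewrite -nth0 nth_drop addn0.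
      + by split => //; rewrite c1 addn0.
    split; first by rewrite j1 mulSnr.
    move=> x y; rewrite ltnS leq_eqVlt => /orP[/eqP ->|]; [exact: j3|exact: j2].
  - by split => //; rewrite mul0n drop0.
by split => // i j; exact: h2.
Qed.

End Pieces.

(** * Comparison with the radii, cluster growth and output *)

Definition base_scale :=
  PFor 12
    (PIf (NLe (NAdd (scal 12) (lit 1)) (scal 16))
       (PR 6 (lit 0) (lit 0) (RAdd (rscal 6) (rvec 4 11)) ;;
        PR 7 (lit 0) (lit 0) (RAdd (rscal 7) (rmat 3 10 11))) PSkip).

(** Array 17 holds the current run, which never exceeds the loop counter; the guard that the counter
    is at most the run thus says that the run is unbroken. *)
Definition add_lead :=
  PFor 12
    (PIf (TAnd (NLe (NAdd (scal 12) (lit 1)) (scal 16))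
            (TAnd (NLe (scal 12) (scal 17)) (NLe (lit 1) (mat 5 10 12))))
       (PN 17 (lit 0) (lit 0) (NAdd (scal 17) (lit 1)) ;;
        PR 6 (lit 0) (lit 0) (RAdd (rscal 6) (rvec 4 11))) PSkip).

(** Both sides of the test are doubled n times while the coins are added on the left; this produces
    the factor [2 ^ n] and the uniform part at once. *)
Definition add_horner :=
  PFor 12
    (PR 7 (lit 0) (lit 0) (RAdd (rscal 7) (rscal 7)) ;;
     PIf (NLe (lit 1) (mat 6 10 12))
       (PR 6 (lit 0) (lit 0) (RAdd (RAdd (rscal 6) (rscal 6)) (rvec 4 11)))
       (PR 6 (lit 0) (lit 0) (RAdd (rscal 6) (rscal 6)))).

Definition reach_table :=
  PFor 10 (PFor 11
    (PR 6 (lit 0) (lit 0) (RSub (rscal 8) (rscal 8)) ;;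
     PR 7 (lit 0) (lit 0) (RSub (rscal 8) (rscal 8)) ;;
     PN 17 (lit 0) (lit 0) (lit 0) ;;
     base_scale ;; add_lead ;; add_horner ;;
     PIf (RLe (rscal 7) (rscal 6))
       (PN 18 (scal 10) (scal 11) (lit 1)) (PN 18 (scal 10) (scal 11) (lit 0)))).

Definition eq_test x y := TAnd (NLe x y) (NLe y x).

Definition grow_round :=
  PFor 12 (PFor 13
    (PIf (TAnd (eq_test (vec 7 12) (NAdd (scal 10) (lit 1)))
            (TAnd (NLe (vec 7 13) (lit 0))
               (TAnd (NLe (lit 1) (mat 1 12 13)) (NLe (lit 1) (mat 18 10 13)))))
       (PN 7 (scal 13) (lit 0) (NAdd (scal 10) (lit 1))) PSkip)).

Definition grow_clusters :=
  PFor 10 (PIf (NLe (lit 1) (mat 2 10 10))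
    (PN 7 (scal 10) (lit 0) (NAdd (scal 10) (lit 1)))
    (PN 7 (scal 10) (lit 0) (lit 0))) ;;
  PFor 10 (PIf (NLe (lit 1) (mat 2 10 10)) (PFor 11 grow_round) PSkip).

Definition write_output :=
  PFor 10 (PN 3 (scal 10) (lit 0) (NSub (vec 7 10) (lit 1))) ;;
  PFor 10 (PFor 11
    (PIf (NLe (lit 1) (mat 1 10 11)) (PN 4 (vec 3 10) (vec 3 11) (lit 1)) PSkip)).

Section Pieces.
Context {R : realType} {n : nat}.
Variables (e : rel 'I_n) (K : {set 'I_n}).
Implicit Types s : @state R.

Section ReachTable.
Variables (dl : 'I_n -> 'I_n -> R) (Dl : 'I_n -> R) (B : nat) (g h : 'I_n -> nat -> bool).
Hypothesis Bn : (B <= n)%N.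

Definition table_radius (j : 'I_n) : nat := (lead (g j) B * 2 ^ n + horner2 (h j) n)%N.

Variable s : @state R.
Hypothesis s16 : nmem s 16 0 0 = B.
Hypothesis s3 : forall u v : 'I_n, rmem s 3 u v = dl u v.
Hypothesis s4 : forall u : 'I_n, rmem s 4 u 0 = Dl u.

Section Cell.
Variables (t u : 'I_n).
Hypotheses (st : nmem s 10 0 0 = t) (su : nmem s 11 0 0 = u).

(** Multiplication by [B] as guarded repeated addition; n rounds suffice because [B] is at most
    n. *)
Lemma den_base_scale : rmem s 6 0 0 = 0 -> rmem s 7 0 0 = 0 ->
  rmem (den n base_scale s) 6 0 0 = B%:R * Dl u /\
  rmem (den n base_scale s) 7 0 0 = B%:R * dl t u.
Proof.
move=> s6 s7; rewrite -(minn_idPr Bn).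
apply: (den_for_ind (I := fun m s => rmem s 6 0 0 = (minn m B)%:R * Dl u /\
  rmem s 7 0 0 = (minn m B)%:R * dl t u)) => //; last by rewrite min0n !mul0r.
move=> m s1 sm f1 f2 [i6 i7]; rewrite /= sm f1 // s16 addn1.
have [mB|Bm] := ltnP m B; last by rewrite i6 i7 (minn_idPr Bm) (minn_idPr (leqW Bm)).
rewrite /upd /= i6 i7 !(f1 10%N) // !(f1 11%N) // (f2 3%N) // (f2 4%N) // st su s3 s4 (minn_idPl mB) (minn_idPl (ltnW mB)).
by rewrite -natr1 !mulrDl !mul1r.
Qed.

Hypothesis s5 : forall i j : 'I_n, nmem s 5 i j = g i j.

Lemma den_add_lead : rmem s 6 0 0 = B%:R * Dl u -> nmem s 17 0 0 = 0%N ->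
  rmem (den n add_lead s) 6 0 0 = (B + lead (g t) B)%N%:R * Dl u.
Proof.
move=> s6 s17; pose I m s' := nmem s' 17 0 0 = lead (g t) (minn m B) /\
  rmem s' 6 0 0 = (B + lead (g t) (minn m B))%N%:R * Dl u.
suff [_] : I n (den n add_lead s) by rewrite (minn_idPr Bn).
apply: (den_for_ind (I := I)) => //; last by rewrite /I min0n addn0.
move=> m s1 sm f1 f2 [i17 i6]; rewrite /= sm (f1 16%N) // (f1 10%N) // (f1 5%N) // s16 st s5 i17 addn1.
have [mB|Bm] := ltnP m B; last by rewrite /I i6 i17 (minn_idPr Bm) (minn_idPr (leqW Bm)).
rewrite /I (minn_idPl mB) [lead _ m.+1]/= eqn_leq lead_le /=.
rewrite (minn_idPl (ltnW mB)) in i17 i6.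
case: (leqP m (lead _ _)) => [lm|_]; case: (g t m) => //=.
have lE : lead (g t) m = m by apply/eqP; rewrite eqn_leq lead_le.
rewrite /upd /= i6 ?i17 lE addn1; split=> //.
by rewrite f1 // su f2 // s4 addnS -natr1 mulrDl mul1r.
Qed.

Hypothesis s5' : forall i j : 'I_n, nmem s 6 i j = h i j.

Lemma den_add_horner A C : rmem s 6 0 0 = A%:R * Dl u -> rmem s 7 0 0 = C%:R * dl t u ->
  rmem (den n add_horner s) 6 0 0 = (A * 2 ^ n + horner2 (h t) n)%N%:R * Dl u /\
  rmem (den n add_horner s) 7 0 0 = (C * 2 ^ n)%N%:R * dl t u.
Proof.
move=> s6 s7.
apply: (den_for_ind (I := fun m s => rmem s 6 0 0 = (A * 2 ^ m + horner2 (h t) m)%N%:R * Dl u /\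
  rmem s 7 0 0 = (C * 2 ^ m)%N%:R * dl t u)) => //; last by rewrite !muln1 addn0.
move=> m s1 sm f1 f2 [i6 i7]; rewrite /= /upd /= (f1 10%N) // (f1 6%N) // sm st s5' expnS -mul2n.
rewrite (_ : C * (2 * 2 ^ m) = C * 2 ^ m + C * 2 ^ m)%N; last by ring.
rewrite (_ : A * (2 * 2 ^ m) + (2 * horner2 (h t) m + h t m) =
  (A * 2 ^ m + horner2 (h t) m) + (A * 2 ^ m + horner2 (h t) m) + h t m)%N; last by ring.
case: (h t m) => /=; rewrite /upd /= i6 i7 ?f1 // ?su ?f2 // ?s4 ?addn0 !natrD !mulrDl ?mul1r.
  by split.
by split.
Qed.

End Cell.
End ReachTable.

Lemma den_reach_table s dl Dl B (g h : 'I_n -> nat -> bool) : (B <= n)%N -> nmem s 16 0 0 = B ->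
  (forall u v : 'I_n, rmem s 3 u v = dl u v) -> (forall u : 'I_n, rmem s 4 u 0 = Dl u) ->
  (forall i j : 'I_n, nmem s 5 i j = g i j) -> (forall i j : 'I_n, nmem s 6 i j = h i j) ->
  forall t u : 'I_n, nmem (den n reach_table s) 18 t u =
    in_reach dl Dl (B * 2 ^ n)%N (table_radius B g h t) t u.
Proof.
move=> Bn s16 s3 s4 s5 s6.
apply: (den_fill2 (get := fun s => nmem s 18)) => // t u s1 st su f1 f2.
rewrite !den_seq.
set p1 := PR 6 _ _ _; set p2 := PR 7 _ _ _; set p3 := PN 17 _ _ _.
set s2 := den n p3 (den n p2 (den n p1 s1)).
set s3' := den n base_scale s2; set s4' := den n add_lead s3'; set s5' := den n add_horner s4'.
have [b6 b7] : rmem s3' 6 0 0 = B%:R * Dl u /\ rmem s3' 7 0 0 = B%:R * dl t u.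
  apply: den_base_scale => //.
  - by rewrite -[LHS]/(nmem s1 16 0 0) f1.
  - by move=> a b; rewrite -[LHS]/(rmem s1 3 a b) f2.
  - by move=> a; rewrite -[LHS]/(rmem s1 4 a 0) f2.
  - by rewrite /= /upd /= subrr.
  - by rewrite /= /upd /= subrr.
have l6 : rmem s4' 6 0 0 = (B + lead (g t) B)%N%:R * Dl u.
  apply: den_add_lead => //.
  - by rewrite /s3' den_nmem // -[LHS]/(nmem s1 16 0 0) f1.
  - by move=> a; rewrite /s3' den_rmem // -[LHS]/(rmem s1 4 a 0) f2.
  - by rewrite /s3' den_nmem.
  - by rewrite /s3' den_nmem.
  - by move=> i j; rewrite /s3' den_nmem // -[LHS]/(nmem s1 5 i j) f1.
  - by rewrite /s3' den_nmem.
have [h6 h7] : rmem s5' 6 0 0 = ((B + lead (g t) B) * 2 ^ n + horner2 (h t) n)%N%:R * Dl u /\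
    rmem s5' 7 0 0 = (B * 2 ^ n)%N%:R * dl t u.
  apply: den_add_horner => //.
  - by move=> a; rewrite /s4' den_rmem // /s3' den_rmem // -[LHS]/(rmem s1 4 a 0) f2.
  - by rewrite /s4' den_nmem // /s3' den_nmem.
  - by rewrite /s4' den_nmem // /s3' den_nmem.
  - by move=> i j; rewrite /s4' den_nmem // /s3' den_nmem // -[LHS]/(nmem s1 6 i j) f1.
  - by rewrite /s4' den_rmem.
have s10 : nmem s5' 10 0 0 = t by rewrite /s5' den_nmem // /s4' den_nmem // /s3' den_nmem.
have s11 : nmem s5' 11 0 0 = u by rewrite /s5' den_nmem // /s4' den_nmem // /s3' den_nmem.
have s18 i j : nmem s5' 18 i j = nmem s1 18 i j.
  by rewrite /s5' den_nmem // /s4' den_nmem // /s3' den_nmem.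
rewrite /in_reach /table_radius addnA -mulnDl -h6 -h7.
split=> [|i j ij]; rewrite /=; case: ifP => //= _; rewrite /upd s10 s11 ?eqxx //=.
  by case: eqP => //= ii; case: eqP => //= jj; case: ij.
by case: eqP => //= ii; case: eqP => //= jj; case: ij.
Qed.

Definition code (o : option (terminal K)) : nat := if o is Some t then (val t).+1 else 0.

Lemma code_some o (t : terminal K) : code o = (val t).+1 -> o = Some t.
Proof. by case: o => //= t' [/val_inj/val_inj ->]. Qed.

Section Growth.
Variables (dl : 'I_n -> 'I_n -> R) (Dl : 'I_n -> R) (N : nat) (X : 'I_n -> nat).

Section Round.
Variables (t : terminal K) (al : 'I_n -> option (terminal K)).
Hypotheses (alt : al (val t) = Some t) (al_only : forall v, al v = Some t -> v = val t).
Let x := X (val t).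
Let be := grow_step e dl Dl N al x t.
Let consistent s := forall v : 'I_n, nmem s 7 v 0 = code (al v) \/ nmem s 7 v 0 = code (be v).

(** The round works in place, but each entry only ever changes from its value before the growth of
    [t] to its value after it, and each pass advances by at least one step along [grow]. *)
Lemma den_grow_round s : has_adj e s -> nmem s 10 0 0 = val t ->
  (forall v : 'I_n, nmem s 18 (val t) v = in_reach dl Dl N x (val t) v) ->
  consistent s ->
  [/\ consistent (den n grow_round s),
    forall v : 'I_n, nmem s 7 v 0 = code (be v) ->
      nmem (den n grow_round s) 7 v 0 = code (be v) &
    forall a b : 'I_n, grow e dl Dl N al x t a b -> be a = Some t ->
      nmem s 7 a 0 = code (be a) -> nmem (den n grow_round s) 7 b 0 = code (be b)].
Proof.
move=> sadj st s18 s7.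
pose le s1 s2 := consistent s1 -> consistent s2 /\
  forall v : 'I_n, nmem s1 7 v 0 = code (be v) -> nmem s2 7 v 0 = code (be v).
have [] // := @den_for2_le R le n (fun a b s1 => le s s1 /\ (grow e dl Dl N al x t a b -> be a = Some t ->
  nmem s 7 a 0 = code (be a) -> nmem s1 7 b 0 = code (be b))) 12 13
  (PIf (TAnd (eq_test (vec 7 12) (NAdd (scal 10) (lit 1)))
            (TAnd (NLe (vec 7 13) (lit 0))
               (TAnd (NLe (lit 1) (mat 1 12 13)) (NLe (lit 1) (mat 18 10 13)))))
       (PN 7 (scal 13) (lit 0) (NAdd (scal 10) (lit 1))) PSkip) s.
- move=> s1 s2 s3 h1 h2 c1; have [c2 m2] := h1 c1; have [c3 m3] := h2 c2.
  by split => // v /m2 /m3.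
- move=> a b s1 s2 [l1 g1] l2; split.
    move=> c0; have [c1 m1] := l1 c0; have [c2 m2] := l2 c1.
    by split => // v /m1 /m2.
  move=> gab bea sa; have [c1 m1] := l1 s7; have [c2 m2] := l2 c1.
  by apply: m2; exact: g1.
- move=> a b s1 sa sb f1 f2 ls1; have [c1 m1] := ls1 s7.
  rewrite /= sa sb (f1 10%N) // st (f1 1%N) // sadj (f1 18%N) // s18 -eqn_leq leqn0 addn1.
  case: ifP => [/and4P[/eqP a7 /eqP b7 eab rb]|nif]; last first.
    split; first by move=> c; split.
    split=> // gab bea sa7; have /and3P[eab /eqP alb rb] := gab.
    have ca := m1 a sa7; have [bN|//] := c1 b.
    move: nif; rewrite ca bea bN alb /= eqxx eab /= rb; by [].
  have alb : al b = None.
    case: (c1 b); rewrite b7 /be /grow_step; first by case: (al b).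
    by case: ifP => // _; case: (al b).
  (* A vertex marked with [t] is either [t] itself or was hit in this growth, so the growing walk
     can continue from it. *)
  have ta : connect (grow e dl Dl N al x t) (val t) a.
    case: (c1 a); rewrite a7 => /esym/code_some; first by move/al_only => ->.
    by rewrite /be /grow_step; case: ifP => [/andP[]//|_ /al_only ->].
  have beb : be b = Some t.
    rewrite /be /grow_step /hit alb eqxx /=; case: ifP => // /negP[].
    apply: connect_trans ta (connect1 _); rewrite /grow /= alb eqxx /=.
    by move: eab rb; rewrite !lt0b => -> ->.
  have up v : nmem (State (upd (nmem s1) 7 b 0 (val t).+1) (rmem s1) (coins s1)) 7 v 0 =
      if v == b :> nat then code (be b) else nmem s1 7 v 0.
    by rewrite /= /upd /= andbT beb.
  have cons2 : le s1 (State (upd (nmem s1) 7 b 0 (val t).+1) (rmem s1) (coins s1)).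
    move=> _; split=> v; rewrite up; case: eqP => [/val_inj ->|_] //; by right.
  split => //; split; last by move=> _ _ _; rewrite up eqxx.
  move=> c0; have [c2 m2] := cons2 c1; split => // v /m1; exact: m2.
move=> h1 h2; have [c m] := h1 s7; split => // a b gab bea sa.
exact: (h2 a b).2.
Qed.

Lemma den_grow_terminal s : has_adj e s -> nmem s 10 0 0 = val t ->
  (forall v : 'I_n, nmem s 18 (val t) v = in_reach dl Dl N x (val t) v) ->
  (forall v : 'I_n, nmem s 7 v 0 = code (al v)) ->
  forall v : 'I_n, nmem (den n (PFor 11 grow_round) s) 7 v 0 = code (be v).
Proof.
move=> sadj st s18 s7.
have bet : be (val t) = Some t by rewrite /be /grow_step /hit alt.
have be_path p : path (grow e dl Dl N al x t) (val t) p -> be (last (val t) p) = Some t.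
  move=> pp; have c : connect (grow e dl Dl N al x t) (val t) (last (val t) p).
    by apply/connectP; exists p.
  case: (grow_connect c) => [->//|[aN _]].
  by rewrite /be /grow_step /hit aN c.
pose I r s' := consistent s' /\ forall p, (size p <= r)%N ->
  path (grow e dl Dl N al x t) (val t) p ->
  nmem s' 7 (last (val t) p) 0 = code (be (last (val t) p)).
have [c h] : I n (den n (PFor 11 grow_round) s).
  apply: (den_for_ind (I := I)) => //.
  - move=> r s' _ f1 f2 [c h].
    have [|||//|c2 m2 g2] := @den_grow_round s'.
    + by move=> a b; rewrite f1 // sadj.
    + by rewrite f1.
    + by move=> a; rewrite f1 // s18.
    split=> // p; elim/last_ind: p => [_ _|p y _].
      by apply: m2; exact: (h [::]).
    rewrite size_rcons ltnS rcons_path last_rcons => sp /andP[pp py].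
    by apply: g2 py _ _; [exact: be_path|exact: h].
  - split; first by move=> v; left.
    by case=> //= _ _; rewrite s7 bet alt.
move=> v; case: (c v) => // sv; rewrite sv /be /grow_step; case: ifP => // /andP[_ hv].
case/connectP: hv sv => p + ->; case/shortenP => q pq uq _ sq.
have sn : (size q <= n)%N.
  by have := max_card (mem (val t :: q)); rewrite (card_uniqP uq) card_ord => /ltnW.
by have := h q sn pq; rewrite sq (be_path q pq).
Qed.

End Round.

Lemma den_grow_clusters s : has_adj e s -> has_terminals K s ->
  (forall t v : 'I_n, nmem s 18 t v = in_reach dl Dl N (X t) t v) ->
  forall v : 'I_n, nmem (den n grow_clusters s) 7 v 0 = code (asg e dl Dl K N X n v).
Proof.
move=> sadj sK s18 v; rewrite /grow_clusters den_seq.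
set p := PFor 10 _; set s1 := den n p s; move: v.
apply: (den_for_ind (I := fun r s => forall v : 'I_n, nmem s 7 v 0 = code (asg e dl Dl K N X r v))) => //.
- move=> i s2 si f1 f2 s7; cbn [den].
  have -> : teval s2 (NLe (lit 1) (mat 2 10 10)) = (i \in K).
    by rewrite /= si f1 // den_nmem // sK lt0b.
  case: ifP => iK; last first.
    by move=> v; rewrite asgSn // => t ti; have := valP t; rewrite (val_inj ti) iK.
  have -> : i = val (Sub i iK : terminal K) by rewrite SubK.
  rewrite asgS; apply: den_grow_terminal => //.
  + exact: asg_terminal.
  + by move=> v /asg_lt[//|]; rewrite ltnn.
  + by move=> a b; rewrite f1 // den_nmem // sadj.
  + by move=> v; rewrite f1 // den_nmem.
- apply: (den_fill (get := fun s x => nmem s 7 x 0)) => // i s2 si f1 f2.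
  have E : nmem s2 2 i i = (i \in K) by rewrite f1 // sK.
  rewrite /= si E lt0b; case: ifP => iK; rewrite /= /upd /= ?eqxx /=.
    split; last by move=> i' /eqP/negbTE ->.
    by rewrite addn1; case: pickP => [t /eqP <- //|/(_ (Sub i iK))]; rewrite SubK eqxx.
  split; last by move=> i' /eqP/negbTE ->.
  by case: pickP => // t /eqP ti; move: iK; rewrite -ti (valP t).
Qed.

End Growth.

Lemma den_write_output s (f : {ffun 'I_n -> terminal K}) : has_adj e s ->
  (forall v : 'I_n, nmem s 7 v 0 = (val (f v)).+1) -> (forall x y, nmem s 4 x y = 0%N) ->
  (forall u : 'I_n, nmem (den n write_output s) 3 u 0 = val (f u)) /\
  forall a b : terminal K, nmem (den n write_output s) 4 (val a) (val b) = Hedge e f a b.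
Proof.
move=> sadj s7 s4; rewrite /write_output den_seq.
set p := PFor 10 (PN _ _ _ _); set s1 := den n p s.
have s13 (u : 'I_n) : nmem s1 3 u 0 = val (f u).
  apply: (den_fill (get := fun s x => nmem s 3 x 0) (g := fun u => val (f u) : nat)) => //.
  move=> i s2 si f1 f2; rewrite /= /upd si !eqxx /= f1 // s7 subn1; split => //.
  by move=> i' /eqP/negbTE ->.
split; first by move=> u; rewrite den_nmem.
pose le (s1 s2 : @state R) := forall a b : terminal K,
  nmem s2 4 (val a) (val b) = nmem s1 4 (val a) (val b) \/
  Hedge e f a b /\ nmem s2 4 (val a) (val b) = 1%N.
have [] // := @den_for2_le R le n (fun u v s1 => e u v -> nmem s1 4 (val (f u)) (val (f v)) = 1%N)
  10 11 (PIf (NLe (lit 1) (mat 1 10 11)) (PN 4 (vec 3 10) (vec 3 11) (lit 1)) PSkip) s1.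
- by move=> s2 a b; left.
- by move=> s2 s3 s5 h1 h2 a b; case: (h2 a b) => [->|]; [exact: h1|right].
- by move=> x s2 a b; left.
- by move=> x s2 a b; left.
- by move=> u v s2 s3 g h euv; case: (h (f u) (f v)) => [->|[_ ->]//]; exact: g.
- move=> u v s2 su sv f1 f2 _.
  have E : nmem s2 1 u v = e u v by rewrite f1 // den_nmem // sadj.
  rewrite /= su sv E lt0b; case: ifP => [euv|nuv]; last first.
    by split => // a b; left.
  rewrite /= ?su ?sv !(f1 3%N) // !s13; split; last by move=> _; rewrite /upd !eqxx.
  move=> a b; rewrite /= /upd /=.
  case: eqP => [/val_inj/val_inj ->|_] /=; last by left.
  case: eqP => [/val_inj/val_inj ->|_] /=; last by left.
  right; split => //; apply/existsP; exists u; apply/existsP; exists v.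
  by rewrite euv !eqxx.
move=> h1 h2 a b; case: (h1 a b) => [E|[-> ->]//].
case ab: (Hedge e f a b); last by rewrite E /s1 den_nmem.
case/existsP: ab => u /existsP[v /and3P[euv /eqP <- /eqP <-]].
exact: h2.
Qed.

End Pieces.

(** * Correctness of the program *)

(** All coins are drawn first and so occupy the initial segment of the tape. [copy 3 1] saves the
    distances of G as edge lengths of H_f before the second [all_distances] overwrites them by those
    of the contracted graph. *)
Definition algorithm :=
  flip_rows 5 ;; flip_rows 6 ;;
  copy 0 2 ;; all_distances ;; nearest_terminals ;; copy 3 1 ;;
  contract_edges ;; all_distances ;; nearest_terminals ;;
  log_terminals ;; reach_table ;; grow_clusters ;; write_output.

Lemma table_val (T : Type) (x0 : T) n (m : 'I_n -> 'I_n -> T) (i j : 'I_n) :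
  table x0 m i j = m i j.
Proof. by rewrite /table !valK. Qed.

Section Correctness.
Context {R : realType} {n T : nat}.
Variables (e : rel 'I_n) (l : 'I_n -> 'I_n -> R) (K : {set 'I_n}) (t0 : terminal K).
Hypotheses (eC : symmetric e) (e_conn : forall u v, connect e u v).
Hypothesis l_ge0 : forall u v, e u v -> 0 <= l u v.
Hypothesis K_gt1 : (1 < #|K|)%N.
(** The lengths as the program sees them: the input table is 0 off the edges. Walks use edges only,
    so [l] and [l0] have the same distances, and [l0] is nonnegative on all pairs, as [total_length]
    requires. *)
Let l0 u v : R := if e u v then l u v else 0.
Let B := up_log 2 #|K|.

Let l0_ge0 u v : 0 <= l0 u v.
Proof. by rewrite /l0; case: ifP => // /l_ge0. Qed.

Lemma up_log_terminals_le : (B <= n)%N.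
Proof.
apply: up_log_min => //; apply: leq_trans (_ : n <= _)%N.
  by rewrite -[X in (_ <= X)%N]card_ord max_card.
exact: ltnW (ltn_expl _ _).
Qed.

Lemma algorithm_outputs (w : T.-tuple bool) :
  (forall u, cluster_of e l0 t0 B w u = Some (zero_ext e l0 t0 B w u)) ->
  outputs e l (zero_ext e l0 t0 B w) (den n algorithm (input e l K w)).
Proof.
move=> total; rewrite /algorithm !den_seq.
set s0 := input e l K w.
have adj0 : has_adj e s0 by move=> u v; rewrite -[LHS]/(table _ _ _ _) table_val.
have ter0 : has_terminals K s0.
  by move=> u; rewrite -[LHS]/(table _ _ _ _) table_val eqxx.
have l00 (u v : 'I_n) : rmem s0 0 u v = l0 u v by rewrite -[LHS]/(table _ _ _ _) table_val.
set s1 := den n (flip_rows 5) s0; set s2 := den n (flip_rows 6) s1.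
have [b5 c5] := @den_flip_rows R n 5 s0 isT isT; rewrite -/s1 in b5 c5.
have [b6 _] := @den_flip_rows R n 6 s1 isT isT; rewrite -/s2 c5 in b6.
set s3 := den n (copy 0 2) s2; set s4 := den n all_distances s3.
set s5 := den n nearest_terminals s4; set s6 := den n (copy 3 1) s5.
set s7 := den n contract_edges s6; set s8 := den n all_distances s7.
set s9 := den n nearest_terminals s8; set s10 := den n log_terminals s9.
set s11 := den n reach_table s10; set s12 := den n grow_clusters s11.
have adj2 : has_adj e s2 by move=> u v; rewrite /s2 den_nmem // /s1 den_nmem.
have ter2 : has_terminals K s2 by move=> u; rewrite /s2 den_nmem // /s1 den_nmem.
have l3 (u v : 'I_n) : rmem s3 2 u v = l0 u v.
  by rewrite /s3 den_copy // /s2 den_rmem // /s1 den_rmem.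
have adj3 : has_adj e s3 by move=> u v; rewrite /s3 den_nmem.
have d4 := den_all_distances e_conn l0_ge0 adj3 l3; rewrite -/s4 in d4.
have ter4 : has_terminals K s4 by move=> u; rewrite /s4 den_nmem // /s3 den_nmem.
have D5 : forall u : 'I_n, rmem s5 4 u 0 = nearest K (val t0) (dist e l0) u.
  by apply: den_nearest => //; [exact: valP|move=> u v; exact: (d4 u v).1|move=> u v; exact: (d4 u v).2].
have d6 (u v : 'I_n) : rmem s6 1 u v = dist e l0 u v.
  by rewrite /s6 den_copy // /s5 den_rmem // (d4 u v).1.
have l7 : forall u v : 'I_n, rmem s7 2 u v = clen e l0 K (val t0) u v.
  apply: den_contract_edges => u; last by rewrite /s6 den_rmem.
  move=> v; rewrite /s6 den_rmem // /s5 den_rmem // /s4 den_rmem // /s3 den_rmem //.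
  by rewrite /s2 den_rmem // /s1 den_rmem.
have adj7 : has_adj e s7.
  by move=> u v; rewrite /s7 den_nmem // /s6 den_nmem // /s5 den_nmem // /s4 den_nmem.
have lam_ge0 u v : 0 <= clen e l0 K (val t0) u v by rewrite /clen; case: ifP.
have d8 := den_all_distances e_conn lam_ge0 adj7 l7; rewrite -/s8 in d8.
have ter8 : has_terminals K s8.
  by move=> u; rewrite /s8 den_nmem // /s7 den_nmem // /s6 den_nmem // /s5 den_nmem.
have D9 : forall u : 'I_n, rmem s9 4 u 0 =
    nearest K (val t0) (dist e (clen e l0 K (val t0))) u.
  by apply: den_nearest => //; [exact: valP|move=> u v; exact: (d8 u v).1|move=> u v; exact: (d8 u v).2].
have ter9 : has_terminals K s9 by move=> u; rewrite /s9 den_nmem.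
have n9 a : a \in [:: 8; 16]%N -> nmem s9 a 0 0 = 0%N.
  move=> a8; have -> : nmem s9 a 0 0 = nmem s0 a 0 0.
    by move: a8; rewrite !inE => /orP[]/eqP ->; rewrite /s9 den_nmem // /s8 den_nmem //
      /s7 den_nmem // /s6 den_nmem // /s5 den_nmem // /s4 den_nmem // /s3 den_nmem //
      /s2 den_nmem // /s1 den_nmem.
  by move: a8; rewrite !inE => /orP[]/eqP ->.
have B10 : nmem s10 16 0 0 = B by apply: den_log_terminals => //; exact: n9.
have bits a i j : a \in [:: 5; 6]%N -> nmem s10 a i j = nmem s2 a i j.
  by rewrite !inE => /orP[]/eqP ->; rewrite /s10 den_nmem // /s9 den_nmem // /s8 den_nmem //
      /s7 den_nmem // /s6 den_nmem // /s5 den_nmem // /s4 den_nmem // /s3 den_nmem.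
pose X := @reach n T B w.
have r11 : forall t u : 'I_n, nmem s11 18 t u =
    in_reach (dist e (clen e l0 K (val t0))) (nearest K (val t0) (dist e (clen e l0 K (val t0))))
      (B * 2 ^ n)%N (X t) t u.
  pose g (i : 'I_n) m := nth false w (@geo_pos n i m).
  pose h (i : 'I_n) m := nth false w (@unif_pos n i m).
  move=> t u; rewrite -[X t]/(table_radius B g h t).
  apply: den_reach_table; [exact: up_log_terminals_le|exact: B10|..].
  - by move=> {}u v; rewrite /s10 den_rmem // /s9 den_rmem // (d8 u v).1.
  - by move=> {}u; rewrite /s10 den_rmem.
  - by move=> i j; rewrite bits // /s2 den_nmem // b5.
  - by move=> i j; rewrite bits // b6 nth_drop.
have adj11 : has_adj e s11.
  by move=> u v; rewrite /s11 den_nmem // /s10 den_nmem // /s9 den_nmem // /s8 den_nmem.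
have ter11 : has_terminals K s11 by move=> u; rewrite /s11 den_nmem // /s10 den_nmem.
have g12 := den_grow_clusters adj11 ter11 r11.
have [out3 out4] : (forall u : 'I_n, nmem (den n write_output s12) 3 u 0 =
    val (zero_ext e l0 t0 B w u)) /\
    forall a b : terminal K, nmem (den n write_output s12) 4 (val a) (val b) =
      Hedge e (zero_ext e l0 t0 B w) a b.
  apply: den_write_output.
  - by move=> u v; rewrite /s12 den_nmem.
  - move=> v; rewrite /s12 g12; have := total v; rewrite /cluster_of -/X => ->.
    by [].
  - move=> x y; rewrite /s12 den_nmem // /s11 den_nmem // /s10 den_nmem // /s9 den_nmem //
      /s8 den_nmem // /s7 den_nmem // /s6 den_nmem // /s5 den_nmem // /s4 den_nmem //.
    by rewrite /s3 den_nmem // /s2 den_nmem // /s1 den_nmem.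
split=> // x y _.
have -> : rmem (den n write_output s12) 1 (val x) (val y) = rmem s6 1 (val x) (val y).
  by rewrite /s12 /s11 /s10 /s9 /s8 /s7; do 7!rewrite den_rmem //.
by rewrite d6 /Hlen; apply: eq_dist => a b eab; rewrite /l0 eab.
Qed.

End Correctness.

(** The image under [f] of a walk in G is a walk in H_f. *)
Lemma Hdist_le_walk (R : realType) (V : finType) (e : rel V) (l : V -> V -> R) (K : {set V})
    (f : {ffun V -> terminal K}) u p :
  (forall a b, e a b -> 0 <= l a b) -> (forall a b, connect e a b) -> path e u p ->
  Hdist e l f (f u) (f (last u p)) <=
    walk_length (fun a b => dist e l (val (f a)) (val (f b))) u p.
Proof.
move=> l_ge0 e_conn pp.
have Hge0 a b : Hedge e f a b -> 0 <= Hlen e l a b by move=> _; exact: dist_ge0.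
apply: le_trans (dist_le Hge0 (p := map f p) _ _) _; last 2 first.
- by rewrite last_map.
- by elim: p u pp => //= a p IH u /andP[_ pa]; rewrite lerD2l IH.
elim: p u pp => //= a p IH u /andP[eua pa]; rewrite IH // andbT.
by apply/existsP; exists u; apply/existsP; exists a; rewrite eua !eqxx.
Qed.

(** The rounded logarithm exceeds log2 k by less than 1, and log2 k is itself at least 1. *)
Lemma up_log_le_ln (R : realType) k : (1 < k)%N ->
  (up_log 2 k)%:R * ln 2 <= 2 * ln k%:R :> R.
Proof.
move=> k1; have /andP[lt _] := up_log_bounds (isT : (1 < 2)%N) k1.
have B0 : (0 < up_log 2 k)%N by rewrite up_log_gt0 k1.
have h1 : (up_log 2 k).-1%:R * ln 2 <= ln k%:R :> R.
  rewrite mulr_natl -lnXn // ler_ln ?posrE ?exprn_gt0 ?ltr0n ?(ltnW k1) //.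
  by rewrite -natrX ler_nat ltnW.
have h2 : ln 2 <= ln k%:R :> R.
  by rewrite ler_ln ?posrE ?ltr0n ?(ltnW k1) // ler_nat.
rewrite -(prednK B0) -natr1 mulrDl mul1r; lra.
Qed.

(* The program c, its running time a * n ^ d, and the constant C are chosen
   before the input.  The coin tape has as many entries as there are steps
   allowed, so it never runs out.  As exec is deterministic, F is determined
   by c and the input: F w is the 0-extension computed on coin outcomes w. *)
Theorem theorem4p4 (R : realType) :
  exists (c : cmd) (a d : nat) (C : R),
  forall (n k : nat) (e : rel 'I_n) (l : 'I_n -> 'I_n -> R) (K : {set 'I_n}),
    symmetric e ->
    (forall u v : 'I_n, connect e u v) ->
    (forall u v : 'I_n, e u v -> l u v = l v u) ->
    (forall u v : 'I_n, e u v -> 0 <= l u v) ->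
    #|K| = k ->
    (2 <= k)%N ->
    exists F : (a * n ^ d)%N.-tuple bool -> {ffun 'I_n -> terminal K},
      [/\ forall w : (a * n ^ d)%N.-tuple bool,
            exists2 s : state,
              halts_within (a * n ^ d)%N c (input e l K w) s
              & outputs e l (F w) s,
          forall w : (a * n ^ d)%N.-tuple bool, connected_0ext e (F w) &
          forall u v : 'I_n,
            coin_expectation (fun w => Hdist e l (F w) (F w u) (F w v))
              <= C * ln k%:R * dist e l u v].
Proof.
(* 380 = 2 * 190: the edge bound has the factor 190 B, and B is at most 2 ln k / ln 2. *)
exists (compile algorithm), (prog_size algorithm), (depth algorithm), (380 / ln 2).
move=> n k e l K eC e_conn lC l_ge0 Kk k1; rewrite -{}Kk in k1 *.
set T := (_ * _)%N.
have n1 : (1 < n)%N by apply: leq_trans k1 _; rewrite -[X in (_ <= X)%N]card_ord max_card.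
have T_cost : (cost n algorithm <= T)%N by apply: cost_le; exact: ltnW.
have T_ge : (2 * (n * n) <= T)%N.
  by apply: leq_mul => //; rewrite mulnn leq_pexp2l // ltnW.
have [x xK] : exists x, x \in K by apply/card_gt0P; exact: ltnW.
pose t0 : terminal K := Sub x xK.
pose l0 u v := if e u v then l u v else 0.
have l0E a b : e a b -> l a b = l0 a b by rewrite /l0 => ->.
have l0_ge0 u v : e u v -> 0 <= l0 u v by move=> euv; rewrite -l0E // l_ge0.
have l0C u v : e u v -> l0 u v = l0 v u by rewrite /l0 eC => evu; rewrite evu lC // eC.
pose B := up_log 2 #|K|.
have Bn : (B <= n)%N by exact: up_log_terminals_le.
have B0 : (0 < B)%N by rewrite up_log_gt0.
have KB : (#|K| <= 2 ^ B)%N by exact: up_logP.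
have total (w : T.-tuple bool) u : cluster_of e l0 t0 B w u = Some (zero_ext e l0 t0 B w u).
  exact: cluster_of_some.
exists (zero_ext e l0 t0 B); split=> [w|w|u v].
- exists (den n algorithm (input e l K w)); last by apply: algorithm_outputs => // u'; exact: total.
  have [|t [tc et _]] := @exec_den R n algorithm (input e l K w) isT isT erefl.
    by rewrite /= size_tuple.
  by exists t => //; exact: leq_trans tc T_cost.
- exact: zero_ext_connected.
have T0 : 0 < 2 ^+ T :> R by rewrite exprn_gt0.
have ln2 : 0 < ln 2 :> R by rewrite ln_gt0 // ltr1n.
rewrite /coin_expectation ler_pdivrMr //.
(* By linearity along a shortest walk of G, the bound for edges gives the bound for all pairs. *)
have [p [pp <- _ wp]] := dist_attained l0_ge0 e_conn u v.
rewrite (eq_dist (l2 := l0)) // -wp.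
apply: le_trans (_ : \sum_(w : T.-tuple bool) walk_length
    (fun a b => dist e l0 (val (zero_ext e l0 t0 B w a)) (val (zero_ext e l0 t0 B w b))) u p <= _).
  apply: ler_sum => w _; apply: le_trans (Hdist_le_walk _ _ _ pp) _ => //.
  rewrite (@eq_walk_length _ _ e _ (fun a b => dist e l0 (val (zero_ext e l0 t0 B w a))
    (val (zero_ext e l0 t0 B w b)))) // => a b _; exact: eq_dist.
apply: le_trans (_ : 190 * B%:R * walk_length l0 u p * 2 ^+ T <= _).
  elim: p u pp {wp} => [|b p IH] u /=; first by rewrite big1 // mulr0 mul0r.
  move=> /andP[eub pb]; rewrite big_split /= mulrDr mulrDl lerD ?IH //.
  exact: expected_edge.
rewrite ler_pM2r // ler_wpM2r ?(walk_length_ge0 l0_ge0) //.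
rewrite mulrAC ler_pdivlMr //; have := @up_log_le_ln R _ k1; rewrite -/B; lra.
Qed.
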